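(* Let $G$ be a finite simple undirected graph in which every vertex has degree at most $3$. Then there is an assignment $v \mapsto B_v$ of a $3$-dimensional axis-parallel box $B_v \subseteq \mathbb{R}^3$ to each vertex $v \in V(G)$ such that for any two distinct vertices $u,v$: $B_u \cap B_v \neq \emptyset$ if and only if $u$ and $v$ are adjacent in $G$. Moreover, the boxes can be chosen so that any two boxes intersect only at their boundaries, i.e. for distinct $u,v$ the set $B_u \cap B_v$ contains no interior point (in $\mathbb{R}^3$) of $B_u$ and no interior point of $B_v$.
   Context: A $3$-dimensional axis-parallel box is a Cartesian product $[a_1,b_1]\times[a_2,b_2]\times[a_3,b_3]$ of three closed intervals of the real line (with $a_i \le b_i$; degenerate intervals are allowed). Equivalently, the conclusion says that $G$ is the intersection graph of a family of such boxes, so $G$ has boxicity at most $3$. *)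

(* Defs.v *)
From mathcomp Require Import all_boot all_order all_algebra.
From mathcomp Require Import all_classical all_reals all_analysis.

Set Implicit Arguments.
Unset Strict Implicit.
Unset Printing Implicit Defensive.

Import Order.TTheory GRing.Theory Num.Theory.
Import numFieldNormedType.Exports.

Local Open Scope classical_set_scope.
Local Open Scope ring_scope.

Definition simple_graph (V : finType) (adj : rel V) : Prop :=
  symmetric adj /\ irreflexive adj.

Definition degree (V : finType) (adj : rel V) (v : V) : nat :=
  #|[pred u | adj v u]|.

(* R^3 is 'rV[R]_3, whose canonical topology is the product topology. *)
Definition box (R : realType) (a b : 'rV[R]_3) : set 'rV[R]_3 :=
  [set x : 'rV[R]_3 | forall i : 'I_3, a 0 i <= x 0 i <= b 0 i].

Definition is_box (R : realType) (B : set 'rV[R]_3) : Prop :=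
  exists a b : 'rV[R]_3, (forall i : 'I_3, a 0 i <= b 0 i) /\ B = box a b.

(* Main.v *)
Require Import Defs.
From mathcomp Require Import all_boot.
From mathcomp Require Import zify.

(** Split the vertices into T and S = V \ T, both inducing maximum degree at most 2, so that T has
    as many inner edges as possible, then as few vertices, then as few isolated vertices, as
    possible. Exchange arguments show that every s in S has at most two neighbours that lie in S or
    have T-degree at most 1 ("heavy" neighbours), and at most one neighbour that is isolated in T.

    Hence the graph Q on S, whose edges are the edges inside S together with the pairs of
    S-neighbours of vertices of T-degree 1, consists of paths and cycles, and so does G[T]. In the
    first coordinate T is laid out along its paths and cycles, while S covers everything. In the
    other two coordinates S is laid out along Q; a vertex of T sits at its S-neighbours and
    stretches upwards in the second coordinate and downwards in the third one to reach its
    T-neighbours, whereas a vertex of S stretches the other way. So vertices of S and T at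
    different places stretch towards each other in only one of these two coordinates, and the other
    one separates them. The closing edge of a cycle of T starts at the lowest vertex of the cycle,
    which the third coordinate separates from the others. The closing edge of a cycle of Q is an
    edge inside S if there is one; otherwise it comes from a vertex of T that is kept short in one
    of the two coordinates. Vertices isolated in T are points far out in the first two coordinates,
    in opposite orders. *)

Set Implicit Arguments.
Unset Strict Implicit.
Unset Printing Implicit Defensive.

(** * Optimal partitions *)

Section Partition.
Context (V : finType) (adj : rel V).
Hypotheses (adjC : symmetric adj) (adjI : irreflexive adj).
Hypothesis deg3 : forall v, #|[set w | adj v w]| <= 3.

Lemma uniq_leq_card (A : {set V}) (s : seq V) : uniq s -> {subset s <= A} -> size s <= #|A|.
Proof. by move=> /card_uniqP <- sA; apply/subset_leq_card/fintype.subsetP. Qed.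

Definition nbrs (A : {set V}) (v : V) : nat := #|[set w in A | adj v w]|.

(** Twice the number of edges induced on [A]. *)
Definition degree_sum (A : {set V}) : nat := \sum_(v in A) nbrs A v.

Lemma nbrsE (A : {set V}) v : nbrs A v = \sum_(w in A) adj v w.
Proof.
rewrite /nbrs -sum1_card big_mkcond [RHS]big_mkcond; apply: eq_bigr => w _.
by rewrite !inE; case: (w \in A); case: adj.
Qed.

Lemma nbrs_add (A : {set V}) v w : v \notin A -> nbrs (v |: A) w = adj w v + nbrs A w.
Proof. by move=> vA; rewrite !nbrsE big_setU1. Qed.

Lemma nbrs_del (A : {set V}) v w : v \in A -> nbrs A w = adj w v + nbrs (A :\ v) w.
Proof. by move=> vA; rewrite !nbrsE (big_setD1 v). Qed.

Lemma nbrs_sub (A B : {set V}) v : A \subset B -> nbrs A v <= nbrs B v.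
Proof.
move=> AB; apply: subset_leq_card; apply/fintype.subsetP => w; rewrite !inE => /andP[wA ->].
by rewrite (fintype.subsetP AB).
Qed.

Lemma nbrs_compl (A : {set V}) v : nbrs A v + nbrs (~: A) v <= 3.
Proof.
apply: leq_trans (deg3 v); rewrite -(cardsID A) leq_eqVlt; apply/orP; left; apply/eqP.
by congr (_ + _); apply: eq_card => w; rewrite !inE andbC.
Qed.

Lemma degree_sum_add (A : {set V}) v :
  v \notin A -> degree_sum (v |: A) = degree_sum A + 2 * nbrs A v.
Proof.
move=> vA; rewrite /degree_sum big_setU1 //= nbrs_add // adjI.
have -> : \sum_(w in A) nbrs (v |: A) w = \sum_(w in A) (adj w v + nbrs A w).
  by apply: eq_bigr => w _; rewrite nbrs_add.
rewrite big_split /= (eq_bigr (fun w => nat_of_bool (adj v w))); last by move=> w _; rewrite adjC.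
rewrite -nbrsE; lia.
Qed.

Lemma degree_sum_del (A : {set V}) v :
  v \in A -> degree_sum A = degree_sum (A :\ v) + 2 * nbrs A v.
Proof.
move=> vA; rewrite -{1}(setD1K vA) degree_sum_add ?setD11 //.
by rewrite (nbrs_del v vA) adjI.
Qed.

Lemma nbrs_gt0 (A : {set V}) v w : w \in A -> adj v w -> 0 < nbrs A v.
Proof. by move=> wA vw; apply/card_gt0P; exists w; rewrite inE wA. Qed.

Definition isolated (T : {set V}) : {set V} := [set t in T | nbrs T t == 0].

Definition admissible (T : {set V}) : bool :=
  [forall v, if v \in T then nbrs T v <= 2 else nbrs (~: T) v <= 2].

(* Compares lexicographically, since the cardinals are at most [#|V|]. *)
Definition weight (T : {set V}) : nat :=
  degree_sum T * #|V|.+1 ^ 2 + (#|V| - #|T|) * #|V|.+1 + (#|V| - #|isolated T|).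

Definition optimal (T : {set V}) : Prop :=
  admissible T /\ forall T', admissible T' -> weight T' <= weight T.

Lemma admissibleP (T : {set V}) : reflect
  ((forall v, v \in T -> nbrs T v <= 2) /\ (forall v, v \notin T -> nbrs (~: T) v <= 2))
  (admissible T).
Proof.
apply: (iffP forallP) => [h|[h1 h2] v]; last by case: ifPn => [/h1|/h2].
by split=> v vT; have := h v; rewrite ?vT ?(negbTE vT).
Qed.

(** The complement of a maximal independent set [S] is admissible: a vertex outside [S] has a
    neighbour in [S], hence at most two outside. *)
Lemma optimal_exists : exists T, optimal T.
Proof.
pose indep (S : {set V}) := [forall v in S, forall w in S, ~~ adj v w].
have [|S /maxsetP[Sind Smax] _] := @maxset_exists _ indep set0.
  by apply/forall_inP => v; rewrite inE.
have adm : admissible (~: S).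
  apply/admissibleP; split=> v; rewrite !inE ?setCK ?negbK => vS.
    have [w wS vw] : exists2 w, w \in S & adj v w.
      apply/exists_inP; apply: contraR vS; rewrite negb_exists_in => /forall_inP vind.
      have <- : v |: S = S; last exact: setU11.
      apply: Smax; last exact: subsetUr.
      apply/forall_inP => x /setU1P xS; apply/forall_inP => y /setU1P yS.
      case: xS yS => [->|xS] [->|yS]; rewrite ?adjI ?vind //; first by rewrite adjC vind.
      by move/forall_inP: Sind => /(_ _ xS)/forall_inP; apply.
    have := nbrs_compl S v; have := nbrs_gt0 wS vw; lia.
  suff -> : nbrs S v = 0 by [].
  apply: eq_card0 => w; rewrite !inE; apply/negP => /andP[wS].
  by move/forall_inP: Sind => /(_ _ vS)/forall_inP/(_ _ wS)/negP.
by case: (arg_maxnP weight adm) => T admT Tmax; exists T.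
Qed.

Lemma optimal_lex (T T' : {set V}) : optimal T -> admissible T' ->
  [/\ degree_sum T' <= degree_sum T,
      degree_sum T' = degree_sum T -> #|T| <= #|T'|
    & degree_sum T' = degree_sum T -> #|T'| = #|T| -> #|isolated T| <= #|isolated T'| ].
Proof.
move=> [_ Tmax] /Tmax; rewrite /weight.
have := max_card T; have := max_card T'.
have := max_card (isolated T); have := max_card (isolated T').
rewrite -!mulnn.
move: (degree_sum T) (degree_sum T') #|T| #|T'| #|V| #|isolated T| #|isolated T'|.
move=> d d' t t' n i i' *.
have [lt|lt|eqd] := ltngtP d d'; [exfalso; nia| split; lia|].
split; [lia| nia| nia].
Qed.

(** * Exchange arguments at an optimal partition *)

Section Optimal.
Context (T : {set V}).
Hypothesis Topt : optimal T.

Let T2 t : t \in T -> nbrs T t <= 2.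
Proof. by case: Topt => /admissibleP[h _ _]; apply: h. Qed.

Let S2 s : s \notin T -> nbrs (~: T) s <= 2.
Proof. by case: Topt => /admissibleP[_ h _]; apply: h. Qed.

Lemma setC_add (A : {set V}) s : ~: (s |: A) = ~: A :\ s.
Proof. by apply/setP => x; rewrite !inE negb_or. Qed.

Lemma setC_del (A : {set V}) s : ~: (A :\ s) = s |: ~: A.
Proof. by apply/setP => x; rewrite !inE negb_and negbK. Qed.

(** Otherwise [t] is the only neighbour of [v] in [T]; moving [v] into [T] leaves [t] with degree at
    most 2 and gains an edge. *)
Lemma nbrs_S_of_end v t : v \notin T -> t \in T -> nbrs T t <= 1 -> adj v t ->
  nbrs (~: T) v <= 1.
Proof.
move=> vT tT t1 vt; rewrite leqNgt; apply/negP => S_v.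
have := nbrs_compl T v; have vt0 := nbrs_gt0 tT vt; move=> v3.
have adm : admissible (v |: T).
  apply/admissibleP; split => x.
    rewrite nbrs_add // => /setU1P[->|xT]; first by rewrite adjI; lia.
    case: (boolP (adj x v)) => [xv|_]; last exact: T2.
    have [<-|xt] := eqVneq t x; first by lia.
    have : nbrs T v = 1 by lia.
    rewrite (nbrs_del v tT) vt /= => -[] /eqP; rewrite cards_eq0 => /eqP/setP/(_ x).
    by rewrite !inE eq_sym xt xT adjC xv.
  rewrite setC_add !inE negb_or => /andP[_ xT].
  by apply: leq_trans (S2 xT); apply: nbrs_sub; apply: subsetDl.
have [+ _ _] := optimal_lex Topt adm; rewrite degree_sum_add //; lia.
Qed.

Definition heavy (s : V) : {set V} := [set v | adj s v & (v \notin T) || (nbrs T v <= 1)].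

Lemma heavy_full s : 2 < #|heavy s| -> heavy s = [set v | adj s v].
Proof.
move=> h; apply/eqP; rewrite eqEcard (leq_trans (deg3 s)) // andbT.
by apply/fintype.subsetP => x; rewrite !inE => /andP[].
Qed.

(* Moving [s] into [T] in exchange for one of three path ends gains an edge. *)
Lemma card_heavy s : s \notin T -> #|heavy s| <= 2.
Proof.
move=> sT; rewrite leqNgt; apply/negP => h.
have full := heavy_full h.
have bad x : x \in T -> adj s x -> nbrs T x <= 1.
  move=> xT sx; have : x \in heavy s by rewrite full inE.
  by rewrite !inE xT sx.
have deg_s : nbrs T s + nbrs (~: T) s = 3.
  apply/eqP; rewrite eqn_leq nbrs_compl.
  apply: leq_trans h _; rewrite full -(cardsID T) leq_eqVlt; apply/orP; left; apply/eqP.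
  by congr (_ + _); apply: eq_card => w; rewrite !inE andbC.
have [t] : exists t, t \in [set w in T | adj s w].
  by apply/card_gt0P; have := S2 sT; rewrite -/(nbrs T s); lia.
rewrite !inE => /andP[tT st]; have t1 := bad _ tT st.
have Ss := nbrs_S_of_end sT tT t1 st.
have adm_del x : x \notin T -> x != s -> nbrs (~: (s |: T :\ t)) x <= 2.
  move=> xT xs; rewrite setC_add setC_del.
  apply: leq_trans (nbrs_sub _ (subsetDl _ _)) _; rewrite nbrs_add ?inE ?negbK //.
  case: (boolP (adj x t)) => [xt|_]; last exact: S2.
  by have := nbrs_S_of_end xT tT t1 xt; lia.
(* If [s] has a neighbour outside [T], it has just two inside and simply joins [T]. Otherwise it has
   three inside, and swapping it for [t] gains two edges and loses at most one. *)
have [S1|S0] := ltnP 0 (nbrs (~: T) s).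
  have adm : admissible (s |: T).
    apply/admissibleP; split => x.
      rewrite nbrs_add // => /setU1P[->|xT]; first by rewrite adjI; lia.
      case: (boolP (adj x s)) => [xs|_]; last exact: T2.
      by have := bad x xT; rewrite adjC => /(_ xs); lia.
    rewrite setC_add !inE negb_or => /andP[_ xT].
    by apply: leq_trans (S2 xT); apply: nbrs_sub; apply: subsetDl.
  have [+ _ _] := optimal_lex Topt adm; rewrite degree_sum_add //; lia.
have sTt : s \notin T :\ t by rewrite !inE negb_and sT orbT.
have s2 : nbrs (T :\ t) s = 2 by have := nbrs_del s tT; rewrite st; lia.
have adm : admissible (s |: T :\ t).
  apply/admissibleP; split => x.
    rewrite nbrs_add // => /setU1P[->|xTt]; first by rewrite adjI; lia.
    have xT : x \in T by case/setD1P: xTt.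
    have := nbrs_del x tT; case: (boolP (adj x s)) => [xs|_]; last by have := T2 xT; lia.
    by have := bad x xT; rewrite adjC => /(_ xs); lia.
  rewrite !inE !negb_or negb_and negbK => /andP[xs /orP[/eqP ->|xT]]; last exact: adm_del.
  have := nbrs_compl (s |: T :\ t) t.
  by have := @nbrs_gt0 (s |: T :\ t) t s; rewrite setU11 adjC => /(_ isT st); lia.
have [+ _ _] := optimal_lex Topt adm; rewrite degree_sum_add //.
have := degree_sum_del tT; lia.
Qed.
Lemma heavy3 s x y z : s \notin T -> uniq [:: x; y; z] ->
  x \in heavy s -> y \in heavy s -> z \in heavy s -> False.
Proof.
move=> sT u hx hy hz; have := card_heavy sT; apply/negP; rewrite -ltnNge.
by apply: (uniq_leq_card u) => v; rewrite !inE => /or3P[] /eqP ->; move: hx hy hz; rewrite !inE.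
Qed.

Lemma nbrs3 s x y z w : uniq [:: x; y; z] -> adj s x -> adj s y -> adj s z -> adj s w ->
  w \in [:: x; y; z].
Proof.
move=> u sx sy sz sw; apply: contraT => w3.
have u4 : uniq [:: w; x; y; z] by rewrite cons_uniq w3.
have := deg3 s; rewrite leqNgt => /negP[].
by apply: (uniq_leq_card u4) => v; rewrite !inE => /or4P[] /eqP ->.
Qed.

Lemma nbrs_compl_lt (A : {set V}) v w : w \in A -> adj v w -> nbrs (~: A) v <= 2.
Proof. by move=> wA vw; have := nbrs_compl A v; have := nbrs_gt0 wA vw; lia. Qed.

(** If [a] had T-degree 1, it could leave [T] together with an end [t], and [s] could enter with two
    edges. For [t] distinct from [a] no edge is lost and [T] shrinks; if they coincide, an edge is
    gained. *)
Lemma inner_of_two_ends s t1 t2 q a : s \notin T -> t1 != t2 ->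
  t1 \in T -> nbrs T t1 <= 1 -> adj s t1 -> t2 \in T -> nbrs T t2 <= 1 -> adj s t2 ->
  q \in T -> nbrs T q = 2 -> adj s q -> a \in T -> adj q a -> nbrs T a = 2.
Proof.
move=> sT t12 t1T t1e st1 t2T t2e st2 qT q2 sq aT qa.
apply/eqP; rewrite eqn_leq T2 //= ltnNge; apply/negP => a1.
have qt1 : q != t1 by apply/eqP => E; move: t1e; rewrite -E q2.
have qt2 : q != t2 by apply/eqP => E; move: t2e; rewrite -E q2.
have aq : a != q by apply/eqP => E; move: qa; rewrite E adjI.
have u : uniq [:: t1; t2; q] by rewrite /= !inE negb_or t12 ![_ == q]eq_sym qt1 qt2.
have nb x : adj s x -> x \in [:: t1; t2; q] by apply: nbrs3.
have sN (A : {set V}) : A \subset T -> s \notin A.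
  by move=> /fintype.subsetP AT; apply: contra sT => /AT.
have a0 : nbrs T a = 1.
  by apply/eqP; rewrite eqn_leq a1 (nbrs_gt0 qT) // adjC.
(* [s] enters [T] in exchange for [a] and [t], which may coincide. *)
have main t : t \in T -> nbrs T t <= 1 -> adj s t -> t != q -> a \notin [:: t1;
  t2] \/ t = a -> False.
  move=> tT te st tq ta.
  pose B := T :\ t :\ a; have BT : B \subset T by apply: subset_trans (subsetDl _ _) (subsetDl _ _).
  have BE x : (x \in B) = [&& x != a, x != t & x \in T] by rewrite !inE.
  have sB := sN _ BT.
  have qB : q \in B by rewrite BE qT ![q == _]eq_sym aq tq.
  have nbB x : nbrs B x <= nbrs T x by apply: nbrs_sub.
  have sB2 : nbrs B s = 2.
    have -> : nbrs B s = nbrs (T :\ t) s.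
      apply: eq_card => x; rewrite !inE; case: eqP => //= ->.
      case: ta => [|->]; last by rewrite eqxx.
      rewrite !inE negb_or => /andP[at1 at2]; case: (boolP (adj s a)) => [/nb|];
        last by rewrite !andbF.
      by rewrite !inE (negbTE at1) (negbTE at2) (negbTE aq).
    have : nbrs T s = 3.
      apply/eqP; rewrite eqn_leq; apply/andP; split;
        first exact: leq_trans (leq_addr _ _) (nbrs_compl T s).
      apply: (uniq_leq_card u) => v.
      by rewrite !inE => /or3P[] /eqP ->; rewrite ?t1T ?t2T ?qT.
    by rewrite (nbrs_del s tT) st => -[].
  have adm : admissible (s |: B).
    apply/admissibleP; split => x.
      rewrite nbrs_add // => /setU1P[->|xB]; first by rewrite adjI sB2.
      case: (boolP (adj x s)) => [|_]; last first.
        by rewrite add0n; apply: leq_trans (nbB x) _; apply: T2; move: xB; rewrite BE => /and3P[].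
      rewrite add1n ltnS.
      rewrite adjC => /nb; rewrite !inE => /or3P[] /eqP ->.
      - exact: leq_trans (nbB t1) t1e.
      - exact: leq_trans (nbB t2) t2e.
      have <- : nbrs (T :\ a) q = 1 by apply/eqP; rewrite -eqSS -q2 (nbrs_del q aT) qa.
      by apply: nbrs_sub; apply/fintype.subsetP => y; rewrite BE !inE => /and3P[-> _ ->].
    have [->|xa] := eqVneq x a.
      by move=> _; apply: (@nbrs_compl_lt _ _ q);
        rewrite ?inE ?BE 1?adjC ?qa // qT ![q == _]eq_sym aq tq orbT.
    have [->|xt] := eqVneq x t.
      by move=> _; apply: (@nbrs_compl_lt _ _ s); rewrite ?setU11 // adjC.
    rewrite in_setU1 negb_or BE xa xt /= => /andP[xs xT].
    (* All neighbours of [x] outside the new set are heavy for the old one, since [a] and [t] have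
       T-degree at most 1. *)
    apply: leq_trans (card_heavy xT); apply: subset_leq_card; apply/fintype.subsetP => y.
    rewrite !inE negb_or !negb_and !negbK => /andP[/andP[_ yB] ->] /=.
    by case/or3P: yB => [/eqP->|/eqP->|->] //; rewrite ?a0 ?te ?orbT.
  have [] := optimal_lex Topt adm; rewrite degree_sum_add // sB2.
  have := degree_sum_del tT.
  have [ta'|ta'] := eqVneq t a.
    have BE2 : B = T :\ t by apply/setP => x; rewrite BE !inE ta'; case: eqP.
    by rewrite BE2 ta' a0; clear; lia.
  have aTt : a \in T :\ t by rewrite !inE eq_sym ta'.
  have := degree_sum_del aTt; have := @nbrs_sub (T :\ t) T a (subsetDl _ _).
  rewrite -/B cardsU1 sB; have := cardsD1 t T; have := cardsD1 a (T :\ t).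
  rewrite aTt tT -/B a0; clear -te; lia.
case: (boolP (a \in [:: t1; t2])) => [a12|]; last by move=> h; apply: (main t1) => //;
  [rewrite eq_sym|left].
have sa : adj s a by move: a12; rewrite !inE => /orP[] /eqP ->.
by apply: (main a) => //; right.
Qed.

(** Without a third neighbour, [s] could join [T] and gain two edges. A third neighbour [q] is not
    heavy, so it has T-degree 2. Swapping [q] for [s] keeps the numbers of edges and vertices; [w1]
    and [w2] cease to be isolated, and no vertex becomes isolated because the T-neighbours of [q]
    have T-degree 2. *)
Lemma isolated_nbr_unique s w1 w2 : s \notin T -> w1 \in isolated T -> w2 \in isolated T ->
  adj s w1 -> adj s w2 -> w1 = w2.
Proof.
rewrite !inE => sT /andP[w1T /eqP w10] /andP[w2T /eqP w20] sw1 sw2.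
apply/eqP; apply: contraT => w12.
have w1h : w1 \in heavy s by rewrite inE sw1 w10 orbT.
have w2h : w2 \in heavy s by rewrite inE sw2 w20 orbT.
have hE x : x \in heavy s -> (x == w1) || (x == w2).
  move=> xh; apply: contraT; rewrite negb_or => /andP[x1 x2].
  by case: (@heavy3 s x w1 w2) => //; rewrite /= !inE negb_or x1 x2 w12.
have [q|noq] := pickP [pred x | adj s x & (x != w1) && (x != w2)]; last first.
  have nb x : adj x s -> (x == w1) || (x == w2).
    by rewrite adjC => sx; move: (noq x); rewrite /= sx; case: eqP => //=; case: eqP.
  have s2 : nbrs T s = 2.
    rewrite (nbrs_del s w1T) sw1 (@nbrs_del (T :\ w1) w2) ?inE 1?eq_sym ?w12 // sw2.
    suff -> : nbrs (T :\ w1 :\ w2) s = 0 by [].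
    apply: eq_card0 => x; rewrite !inE; apply/negP => /andP[/and3P[x2 x1 _]].
    by rewrite adjC => /nb; rewrite (negbTE x1) (negbTE x2).
  have adm : admissible (s |: T).
    apply/admissibleP; split => x.
      rewrite nbrs_add // => /setU1P[->|xT]; first by rewrite adjI s2.
      case: (boolP (adj x s)) => [/nb/orP[]/eqP->|_]; rewrite ?w10 ?w20 //; exact: T2.
    rewrite setC_add !inE negb_or => /andP[_ xT].
    by apply: leq_trans (S2 xT); apply: nbrs_sub; apply: subsetDl.
  have [+ _ _] := optimal_lex Topt adm; rewrite degree_sum_add // s2; clear; lia.
move=> /= /and3P[sq q1 q2].
have qh : q \notin heavy s by apply/negP => /hE; rewrite (negbTE q1) (negbTE q2).
have [qT qn] : q \in T /\ nbrs T q = 2.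
  move: qh; rewrite inE sq negb_or negbK /= -ltnNge => /andP[qT qn].
  by split=> //; apply/eqP; rewrite eqn_leq T2.
have u : uniq [:: w1; w2; q] by rewrite /= !inE negb_or w12 ![_ == q]eq_sym q1 q2.
have nb x : adj s x -> x \in [:: w1; w2; q] by apply: nbrs3.
have inner a : a \in T -> adj q a -> nbrs T a = 2.
  by apply: (@inner_of_two_ends s w1 w2); rewrite ?w10 ?w20.
have sB : s \notin T :\ q by rewrite !inE negb_and sT orbT.
have s2 : nbrs (T :\ q) s = 2.
  have : nbrs T s = 3.
    apply/eqP; rewrite eqn_leq; apply/andP; split;
      first exact: leq_trans (leq_addr _ _) (nbrs_compl T s).
    apply: (uniq_leq_card u) => v.
    by rewrite !inE => /or3P[] /eqP ->; rewrite ?w1T ?w2T ?qT.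
  by rewrite (nbrs_del s qT) sq => -[].
have nbB x : nbrs (T :\ q) x <= nbrs T x by apply: nbrs_sub; apply: subsetDl.
have adm : admissible (s |: T :\ q).
  apply/admissibleP; split => x.
    rewrite nbrs_add // => /setU1P[->|/setD1P[xq xT]]; first by rewrite adjI s2.
    case: (boolP (adj x s)) => [|_]; last by apply: leq_trans (nbB x) (T2 xT).
    rewrite adjC => /nb; rewrite !inE (negbTE xq) orbF => /orP[] /eqP ->.
      by have := nbB w1; rewrite w10 leqn0 => /eqP ->.
    by have := nbB w2; rewrite w20 leqn0 => /eqP ->.
  have [->|xq] := eqVneq x q.
    by move=> _; apply: (@nbrs_compl_lt _ _ s); rewrite ?setU11 // adjC.
  rewrite in_setU1 negb_or in_setD1 xq /= => /andP[xs xT].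
  rewrite setC_add setC_del; apply: leq_trans (nbrs_sub _ (subsetDl _ _)) _.
  rewrite nbrs_add ?inE ?negbK //; case: (boolP (adj x q)) => [xq'|_]; last exact: S2.
  have := nbrs_compl T q; rewrite qn => qS.
  have : nbrs [set s; x] q <= nbrs (~: T) q.
    by apply: nbrs_sub; apply/fintype.subsetP => y; rewrite !inE => /orP[]/eqP->.
  rewrite nbrsE big_setU1 ?inE 1?eq_sym //= big_set1 [adj q s]adjC sq [adj q x]adjC xq';
    move: qS; clear; lia.
have [_ _] := optimal_lex Topt adm.
rewrite degree_sum_add // s2; have := degree_sum_del qT; rewrite qn => -> /(_ erefl).
rewrite cardsU1 sB; have := cardsD1 q T; rewrite qT => -> /(_ erefl).
have w1W : w1 \in isolated T by rewrite inE w1T w10.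
suff sub : isolated (s |: T :\ q) \subset isolated T :\ w1.
  have := subset_leq_card sub; have := cardsD1 w1 (isolated T); rewrite w1W; clear; lia.
apply/fintype.subsetP => x; rewrite !inE nbrs_add //.
have [->|xs] := eqVneq x s; first by rewrite adjI s2.
move=> /= /andP[/andP[xq xT]]; rewrite addn_eq0 eqb0 => /andP[xs' x0].
rewrite xT /=; apply/andP; split; first by apply: contraNneq xs' => ->; rewrite adjC.
have := nbrs_del x qT; rewrite (eqP x0) addn0 => ->.
case: (boolP (adj x q)) => // xq'; exfalso.
by have := inner _ xT; rewrite adjC => /(_ xq'); have := nbrs_del x qT;
  rewrite (eqP x0) xq' => ->.
Qed.

End Optimal.
End Partition.

(** * Layouts of graphs of maximum degree two *)

Section Layout.
Context (V : finType) (e : rel V) (good : seq V -> Prop).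
Hypotheses (eC : symmetric e) (eI : irreflexive e).

(** [c] is a cyclic component of the graph on [A], cut open at the edge between [a] and [b]; [good]
    says which cuts are acceptable. *)
Definition closing (A : {set V}) (pos : V -> nat) (a b : V) (c : seq V) : Prop :=
  [/\ [/\ good c, uniq c, cycle e c & 2 < size c] /\ index a c = 0 /\ index b c = (size c).-1,
      {subset c <= A},
      forall v w, v \in c -> w \in A -> e v w -> w \in c,
      forall v, v \in A -> (v \in c) = (pos a <= pos v <= pos b)
    & forall v w, v \in c -> w \in c -> e v w -> pos v < pos w ->
        pos w = (pos v).+1 \/ v = a /\ w = b].

Definition layout (A : {set V}) (pos : V -> nat) : Prop :=
  [/\ {in A &, injective pos},
      forall v, v \in A -> pos v < #|A|
    & forall a b, a \in A -> b \in A -> e a b -> pos a < pos b ->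
        pos b = (pos a).+1 \/ exists c, closing A pos a b c].

Section Path.
Context (A : {set V}).
Hypothesis deg2 : forall v, v \in A -> nbrs e A v <= 2.

Lemma no_three v x y z : v \in A -> uniq [:: x; y; z] -> x \in A -> y \in A -> z \in A ->
  e v x -> e v y -> e v z -> False.
Proof.
move=> vA u xA yA zA vx vy vz; have := deg2 vA; apply/negP; rewrite -ltnNge.
by apply: (uniq_leq_card u) => w; rewrite !inE => /or3P[]/eqP->; apply/andP.
Qed.

(** An inner vertex of the path already has its two neighbours there, so any further edge joins the
    two ends. *)
Lemma path_edges (c : seq V) v w : uniq c -> sorted e c -> {subset c <= A} ->
  v \in c -> w \in c -> e v w -> index v c < index w c ->
  index w c = (index v c).+1 \/ index v c = 0 /\ index w c = (size c).-1.
Proof.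
move=> cu ce cA vc wc vw; have vA := cA _ vc; have wA := cA _ wc.
case/splitPr: vc cu ce cA wc => p1 p2 cu ce cA wc.
have vp1 : v \notin p1 by move: cu; rewrite cat_uniq /= negb_or => /and3P[_ /andP[]].
rewrite !index_cat (negbTE vp1) /= eqxx addn0.
have [wp1|wp1] := boolP (w \in p1); first by have := wp1; rewrite -index_mem /=; clear; lia.
have wv : v != w by apply: contraTneq vw => ->; rewrite eI.
rewrite (negbTE wv); have wp2 : w \in p2.
  by move: wc; rewrite mem_cat inE (negbTE wp1) eq_sym (negbTE wv).
move=> _; case: p2 => [//|y p2] in cu ce cA wc wp2 *.
have [->|wy] := eqVneq w y; first by left; rewrite /= eqxx; clear; lia.
have vy : e v y.
  by move: ce; rewrite sorted_cat_cons /= => /andP[_ /andP[]].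
have yA : y \in A by apply: cA; rewrite mem_cat !inE eqxx !orbT.
right; case/lastP: p1 => [|p1 x] in cu ce cA wc vp1 wp1 *; last first.
  exfalso; apply: (@no_three v x y w) => //.
  - move: cu; rewrite cat_uniq => /and3P[_ /hasPn cu _].
    rewrite /= !inE negb_or [y == w]eq_sym wy !andbT; apply/andP; split.
      by apply: contraTneq (cu y _) => [->|]; rewrite ?inE ?eqxx ?orbT // mem_rcons inE eqxx.
    by apply: contraNneq wp1 => <-; rewrite mem_rcons inE eqxx.
  - by apply: cA; rewrite mem_cat mem_rcons inE eqxx.
  - rewrite eC; move: ce; rewrite cat_rcons sorted_cat_cons => /andP[_] /=.
    by case/andP.
split=> //=; have wp : w \in p2 by move: wp2; rewrite inE (negbTE wy).
rewrite eq_sym (negbTE wy).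
case/splitPr: wp cu ce cA wc wp2 => p3 p4 cu ce cA wc wp2.
have wp3 : w \notin p3.
  by move: cu; rewrite /= cat_uniq /= !negb_or => /and4P[_ _ _ /andP[/andP[]]].
rewrite index_cat (negbTE wp3) /= eqxx.
case: p4 => [|z p4] in cu ce cA wc wp2 *; first by rewrite size_cat /=; clear; lia.
exfalso; apply: (@no_three w (last y p3) v z) => //.
- have := cu; rewrite cat0s -[v :: _]/([:: v] ++ (y :: p3) ++ [:: w, z & p4]).
  rewrite cat_uniq => /and3P[_ /hasPn vN]; rewrite cat_uniq => /and3P[_ /hasPn zN _].
  have lv : last y p3 != v by have := vN (last y p3); rewrite mem_cat mem_last !inE; apply.
  have vz : v != z.
    by have := vN z; rewrite !(mem_cat, inE) eqxx !orbT eq_sym; apply.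
  have lz : last y p3 != z.
    have := zN z; rewrite !inE eqxx orbT => /(_ isT); apply: contraNneq => <-; exact: mem_last.
  by rewrite /= !inE negb_or lv lz vz.
- by apply: cA; have := mem_last y p3; rewrite !(inE, mem_cat) => /orP[] ->; rewrite !orbT.
- by apply: cA; rewrite !(inE, mem_cat) eqxx !orbT.
- by rewrite eC; move: ce; rewrite /= cat_path /= => /and3P[_ _ /andP[]].
- by rewrite eC.
- by move: ce; rewrite /= cat_path /= => /and3P[_ _ /and3P[]].
Qed.

(** Take a longest path: a neighbour outside it would extend it at an end or be the third neighbour
    of an inner vertex. *)
Lemma maximal_path : A != set0 -> exists c, [/\ uniq c, sorted e c, {subset c <= A},
  0 < size c & forall v w, v \in c -> w \in A -> e v w -> w \in c].
Proof.
case/set0Pn => x0 x0A.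
pose ok (c : seq V) := [&& uniq c, sorted e c & all (mem A) c].
pose P m := [exists c : m.-tuple V, ok c].
have P1 : exists m, P m by exists 1; apply/existsP; exists [tuple x0]; rewrite /ok /= x0A.
have Pmax m : P m -> m <= #|A|.
  case/existsP => c /and3P[cu _ /allP cA]; rewrite -(size_tuple c).
  exact: uniq_leq_card.
case: (ex_maxnP P1 Pmax) => m /existsP[c /and3P[cu ce /allP cA]] mmax.
have notlonger (d : seq V) : ok d -> size d <= size c.
  by move=> dok; rewrite size_tuple; apply: mmax; apply/existsP; exists (in_tuple d).
have c0 : 0 < size c by have := notlonger [:: x0]; rewrite /ok /= x0A; apply.
exists c; split=> // v w vc wA vw; apply: contraT => wc.
have vA : v \in A by apply: cA.
case: c => c /= _ in cu ce cA notlonger c0 vc wc *.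
case/splitPr: vc cu ce cA notlonger c0 wc => p1 p2 cu ce cA notlonger c0 wc.
have wA' : forall d : seq V, {subset d <= w :: p1 ++ v :: p2} -> all (mem A) d.
  by move=> d dsub; apply/allP => z /dsub; rewrite inE => /predU1P[->|/cA].
case: p1 => [|a p1] in cu ce cA notlonger c0 wc wA' *.
  have := notlonger (w :: v :: p2); rewrite /= ltnn; apply.
  rewrite /ok cons_uniq wc cu wA' //= eC vw andbT; exact: ce.
case: p2 => [|b p2] in cu ce cA notlonger c0 wc wA' *.
  have := notlonger (rcons ((a :: p1) ++ [:: v]) w); rewrite size_rcons ltnn; apply.
  rewrite /ok rcons_uniq wc cu (wA' (rcons _ _)); last by move=> y; rewrite mem_rcons.
  by rewrite /= rcons_path last_cat /= vw !andbT; move: ce.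
exfalso; apply: (@no_three v (last a p1) b w) => //.
- move: cu; rewrite cat_uniq => /and3P[_ /hasPn cu _].
  have lb : last a p1 != b.
    have := cu b; rewrite !inE eqxx orbT => /(_ isT); apply: contraNneq => <-; exact: mem_last.
  have lw : last a p1 != w by apply: contraNneq wc => <-; rewrite mem_cat mem_last.
  have bw : b != w by apply: contraNneq wc => <-; rewrite mem_cat !inE eqxx !orbT.
  by rewrite /= !inE negb_or lb lw bw.
- by apply: cA; rewrite mem_cat mem_last.
- by apply: cA; rewrite mem_cat !inE eqxx !orbT.
- by rewrite eC; move: ce; rewrite /= cat_path /= => /and3P[].
- by move: ce; rewrite /= cat_path /= => /and3P[_ _ /andP[]].
Qed.

End Path.

(* A component is numbered consecutively along a maximal path, and the numbering
   proceeds by induction on the remaining vertices. *)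
Lemma layout_exists (A : {set V}) :
  (forall v, v \in A -> nbrs e A v <= 2) ->
  (forall c, uniq c -> cycle e c -> 2 < size c -> {subset c <= A} ->
     exists i, good (rot i c)) ->
  exists pos, layout A pos.
Proof.
move: {2}#|A|.+1 (ltnSn #|A|) => n; elim: n A => // n IH A; rewrite ltnS => An deg2 rot_good.
have [->|A0] := eqVneq A set0.
  by exists (fun=> 0); split=> [v w|v|v w]; rewrite inE.
have [c [[cu ce cA c0 cclosed] cgood]] : exists c, [/\ uniq c, sorted e c, {subset c <= A},
    0 < size c & forall v w, v \in c -> w \in A -> e v w -> w \in c] /\
    (forall v w, v \in c -> w \in c -> e v w -> index v c = 0 -> index w c = (size c).-1 ->
       2 < size c -> good c /\ cycle e c).
  have [p [pu pe pA p0 pclosed]] := maximal_path deg2 A0.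
  (* If the path closes up to a cycle, it is rotated to a good cut; otherwise the condition on
     [good] is vacuous. *)
  have [pcyc|pcyc] := boolP (cycle e p && (2 < size p)); last first.
    exists p; split=> // v w vp wp vw v0 wlast p2; exfalso; move/negP: pcyc; apply.
    rewrite p2 andbT; case: p pu pe pA p0 pclosed vp wp v0 wlast p2 =>
      // x p pu pe pA p0 pclosed vp wp v0 wlast p2.
    rewrite /= rcons_path (pe : path e x p) /=.
    have -> : last x p = w by rewrite (last_nth x); have := nth_index x wp; rewrite wlast.
    by have := nth_index x vp; rewrite v0 /= => ->; rewrite eC.
  case/andP: pcyc => pcyc p2; have [i igood] := rot_good p pu pcyc p2 pA.
  exists (rot i p); rewrite rot_uniq size_rot; split; last by rewrite rot_cycle.
  split=> // [|v|v w]; last 2 first.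
  - by rewrite mem_rot; apply: pA.
  - by rewrite !mem_rot; apply: pclosed.
  have : cycle e (rot i p) by rewrite rot_cycle.
  by case: (rot i p) => //= x q; rewrite rcons_path => /andP[].
have DA : A :\: [set x in c] \subset A by apply: subsetDl.
have Dcard : #|A :\: [set x in c]| + size c = #|A|.
  rewrite -(cardsID [set x in c] A) addnC; congr (_ + _).
  rewrite -(card_uniqP cu); apply: eq_card => x; rewrite !inE.
  by have := cA x; case: (x \in c); rewrite ?andbF // => ->.
have DE x : (x \in A :\: [set x in c]) = (x \notin c) && (x \in A) by rewrite !inE.
have [|||pos' [pinj pbound pedge]] := IH (A :\: [set x in c]).
- by move: Dcard c0 An; clear; lia.
- by move=> v vD; apply: leq_trans (nbrs_sub _ _ DA) (deg2 _ _); apply: (fintype.subsetP DA).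
- by move=> d du dc d2 dD; apply: rot_good => // x /dD; apply: (fintype.subsetP DA).
(* The path takes the first positions; the remaining vertices follow, shifted by its length. *)
pose pos v := if v \in c then index v c else size c + pos' v.
have posc v : v \in c -> pos v = index v c /\ pos v < size c.
  by move=> vc; rewrite /pos vc index_mem.
have posN v : v \notin c -> pos v = size c + pos' v by move=> /negbTE vc; rewrite /pos vc.
have edgec v w : v \in A -> w \in A -> e v w -> (v \in c) = (w \in c).
  move=> vA wA vw; apply/idP/idP => [vc|wc]; first exact: cclosed vc wA vw.
  by apply: cclosed wc vA _; rewrite eC.
exists pos; split.
- move=> v w vA wA; have [vc|vc] := boolP (v \in c); have [wc|wc] := boolP (w \in c).
  + by rewrite (posc v vc).1 (posc w wc).1 => /(congr1 (nth v c)); rewrite !nth_index.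
  + by have := (posc v vc).2; rewrite (posN w wc); clear; lia.
  + by have := (posc w wc).2; rewrite (posN v vc); clear; lia.
  + by rewrite !posN // => /addnI; apply: pinj; rewrite DE ?vc ?wc.
- move=> v vA; have [vc|vc] := boolP (v \in c).
    by have := (posc v vc).2; move: Dcard; clear; lia.
  by have := pbound v; rewrite DE vc vA (posN v vc) => /(_ isT); move: Dcard; clear; lia.
move=> a b aA bA ab; have := edgec _ _ aA bA ab.
have [ac|ac] := boolP (a \in c) => /esym bc.
  rewrite (posc a ac).1 (posc b bc).1 => iab.
  case: (path_edges deg2 cu ce cA ac bc ab iab) => [->|[a0 blast]]; first by left.
  have [c2|c2] := ltnP 2 (size c); last (left; rewrite a0 blast; move: c2 iab;
    rewrite a0 blast; by case: (size c) => [|[|[|]]]).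
  have [good_c cyc_c] := cgood a b ac bc ab a0 blast c2.
  right; exists c; split=> //.
  - move=> v vA; rewrite (posc a ac).1 (posc b bc).1 a0 blast.
    have [vc|vc] := boolP (v \in c).
      by rewrite -(ltnS _ (size c).-1) prednK // (posc v vc).2.
    by rewrite (posN v vc) -(ltnS _ (size c).-1) prednK // ltnNge leq_addr.
  - move=> v w vc wc vw; rewrite (posc v vc).1 (posc w wc).1 => ivw.
    case: (path_edges deg2 cu ce cA vc wc vw ivw) => [->|[v0 wlast]]; [by left|right].
    by rewrite -(nth_index a vc) -(nth_index a wc) v0 wlast -a0 -blast !nth_index.
have bN : b \notin c by rewrite bc.
rewrite !posN // ltn_add2l => lab.
have aD : a \in A :\: [set x in c] by rewrite DE ac aA.
have bD : b \in A :\: [set x in c] by rewrite DE bN bA.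
case: (pedge a b aD bD ab lab) => [->|[d [[[gd du dc d2] dab] dD dclosed drange dedge]]].
  by left; rewrite addnS.
have dN v : v \in d -> v \notin c by move=> /dD; rewrite DE => /andP[].
right; exists d; split=> //.
- by move=> v /dD; apply: (fintype.subsetP DA).
- move=> v w vd wA vw; apply: (dclosed v w) => //; rewrite DE wA andbT.
  by rewrite -(edgec v w) ?dN //; apply: (fintype.subsetP DA); apply: dD.
- move=> v vA; rewrite (posN a ac) (posN b bN); have [vc|vc] := boolP (v \in c).
    have -> : (v \in d) = false by apply/negP => /dN; rewrite vc.
    by have := (posc v vc).2; clear; lia.
  by rewrite (posN v vc) drange ?DE ?vc // !leq_add2l.
- move=> v w vd wd vw; rewrite !posN ?dN // ltn_add2l => lvw.
  by case: (dedge v w vd wd vw lvw) => [->|]; [left; rewrite addnS|right].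
Qed.

End Layout.

(** * Minima and maxima with a default value *)

Section MinMax.
Context (I : finType).
Implicit Types (Q : pred I) (F : I -> nat).

Lemma min_with_ex d Q F : exists m, (m == d) || [exists i, Q i && (F i == m)].
Proof. by exists d; rewrite eqxx. Qed.

Definition min_with d Q F : nat := ex_minn (min_with_ex d Q F).

Lemma min_withP d Q F :
  [/\ min_with d Q F <= d, forall i, Q i -> min_with d Q F <= F i
    & min_with d Q F = d \/ exists2 i, Q i & min_with d Q F = F i].
Proof.
rewrite /min_with; case: ex_minnP => m m_ex m_min; split.
- by apply: m_min; rewrite eqxx.
- by move=> i Qi; apply: m_min; apply/orP; right; apply/existsP; exists i; rewrite Qi eqxx.
- by case/orP: m_ex => [/eqP ->|/existsP[i /andP[Qi /eqP <-]]]; [left|right; exists i].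
Qed.

Definition max_with d Q F : nat := maxn d (\max_(i | Q i) F i).

Lemma max_withP d Q F :
  [/\ d <= max_with d Q F, forall i, Q i -> F i <= max_with d Q F
    & max_with d Q F = d \/ exists2 i, Q i & max_with d Q F = F i].
Proof.
rewrite /max_with; split; first exact: leq_maxl.
  by move=> i Qi; apply: leq_trans (leq_maxr _ _); apply: leq_bigmax_cond.
have [Q0|/pred0Pn[i Qi]] := eqVneq #|Q| 0.
  by left; rewrite big_pred0 ?maxn0 // => i; apply/negP => Qi; move/card0_eq: Q0 => /(_ i);
    rewrite inE => /negP; apply.
have [|j Qj ->] := @eq_bigmax_cond _ Q F; first by apply/card_gt0P; exists i.
by rewrite /maxn; case: ifP => _; [right; exists j|left].
Qed.
End MinMax.

Lemma cycle_two_nbrs (V : finType) (e : rel V) (c : seq V) v : symmetric e ->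
  uniq c -> cycle e c -> 2 < size c -> v \in c ->
  [/\ next c v \in c, prev c v \in c, next c v != prev c v, e v (next c v) & e v (prev c v)].
Proof.
move=> eC cu cc c2 vc; rewrite mem_next mem_prev vc (next_cycle cc vc) eC (prev_cycle cc vc).
split=> //; apply/eqP => /(congr1 (next c)); rewrite next_prev //; apply/eqP.
have [i p Ep] := rot_to vc; rewrite -!(next_rot i cu) Ep.
have pu : uniq (v :: p) by rewrite -Ep rot_uniq.
have : 2 < size (v :: p) by rewrite -Ep size_rot.
case: p pu {Ep} => [|x [|y p]] //= /andP[vN _] _.
rewrite eqxx; move: vN; rewrite !inE !negb_or => /and3P[vx vy _].
by rewrite [x == v]eq_sym (negbTE vx) eqxx eq_sym.
Qed.

Lemma last_head_cycle (V : eqType) (x : V) p : uniq (x :: p) -> next (x :: p) (last x p) = x.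
Proof.
move=> pu; rewrite next_nth mem_last.
have -> : index (last x p) (x :: p) = size p by rewrite (last_nth x) index_uniq.
by rewrite nth_default.
Qed.

(** * Levels of the quotient graph *)

Section Placement.
Context (V : finType) (adj : rel V).
Hypotheses (adjC : symmetric adj) (adjI : irreflexive adj).
Hypothesis deg3 : forall v, #|[set w | adj v w]| <= 3.
Context (T : {set V}).
Hypothesis Topt : optimal adj T.

Local Notation deg := (nbrs adj).
Local Notation heavy := (heavy adj T).
Local Notation isolated := (isolated adj T).

Definition path_end (u : V) : bool := (u \in T) && (deg T u == 1).

Definition quotient_edge (s s' : V) : bool :=
  [&& s \notin T, s' \notin T, s != s' &
      adj s s' || [exists u, [&& path_end u, adj u s & adj u s']]].

Lemma quotient_edgeC : symmetric quotient_edge.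
Proof.
move=> s s'; rewrite /quotient_edge andbCA [s == s']eq_sym [adj s s']adjC.
by congr [&& _, _, _ & _ || _]; apply: eq_existsb => u; rewrite [adj u s && _]andbC.
Qed.

Lemma quotient_edgeI : irreflexive quotient_edge.
Proof. by move=> s; rewrite /quotient_edge eqxx !andbF. Qed.

(** A witness [v], adjacent to [s], for an edge of the quotient graph. Counting witnesses transfers
    the bound on heavy neighbours to this graph. *)
Definition link (s v s' : V) : bool := adj s v && ((v == s') || path_end v && adj v s').

Lemma link_heavy s v s' : s' \notin T -> link s v s' -> v \in heavy s.
Proof.
by move=> s'T /andP[sv /orP[/eqP E|/andP[/andP[vT v1] _]]];
  rewrite inE sv ?E ?s'T // (eqP v1) orbT.
Qed.

Lemma quotient_link s s' : quotient_edge s s' -> exists v, link s v s'.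
Proof.
case/and4P => _ _ _ /orP[ss'|/existsP[u /and3P[u1 us us']]].
  by exists s'; rewrite /link ss' eqxx.
by exists u; rewrite /link adjC us u1 us' orbT.
Qed.

Lemma T_nbrs_le2 t : t \in T -> deg T t <= 2.
Proof. by case: Topt => /admissibleP[h _ _]; apply: h. Qed.

Lemma path_end_nbrs u x y z : path_end u -> uniq [:: x; y; z] ->
  x \notin T -> y \notin T -> z \notin T -> adj u x -> adj u y -> adj u z -> False.
Proof.
move=> /andP[uT /eqP u1] xyz xT yT zT ux uy uz.
have := nbrs_compl deg3 T u; rewrite u1 add1n ltnS; apply/negP; rewrite -ltnNge.
by apply: (uniq_leq_card xyz) => w; rewrite !inE => /or3P[]/eqP->; apply/andP.
Qed.

(** A path end has at most two neighbours outside [T], one of which is [s]. *)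
Lemma link_inj s v s1 s2 : s \notin T -> s1 \notin T -> s2 \notin T -> s1 != s -> s2 != s ->
  link s v s1 -> link s v s2 -> s1 = s2.
Proof.
move=> sT s1T s2T s1s s2s /andP[sv l1] /andP[_ l2]; apply/eqP.
case/orP: l1 => [/eqP E1|/andP[v1 vs1]]; case/orP: l2 => [/eqP E2|/andP[v2 vs2]].
- by rewrite -E1 E2.
- by move: v2; rewrite /path_end E1 (negbTE s1T).
- by move: v1; rewrite /path_end E2 (negbTE s2T).
- apply: contraT => s12; exfalso; apply: (@path_end_nbrs v s s1 s2) => //; last by rewrite adjC.
  by rewrite /= !inE negb_or ![s == _]eq_sym s1s s2s s12.
Qed.

(** Distinct neighbours in the quotient graph have distinct links, all of which lie in [heavy s]. *)
Lemma quotient_nbrs s : s \notin T -> nbrs quotient_edge (~: T) s <= 2.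
Proof.
move=> sT; apply: leq_trans (card_heavy adjC adjI deg3 Topt sT).
pose f s' := odflt s [pick v | link s v s'].
have fP s' : quotient_edge s s' -> link s (f s') s'.
  by move=> /quotient_link[v sv]; rewrite /f; case: pickP => [//|/(_ v)]; rewrite sv.
have finj : {in [set s' in ~: T | quotient_edge s s'] &, injective f}.
  move=> s1 s2; rewrite !inE => /andP[s1T Q1] /andP[s2T Q2] E.
  have := fP _ Q1; rewrite E => l1; apply: link_inj l1 (fP _ Q2) => //.
    by case/and4P: Q1 => _ _; rewrite eq_sym.
  by case/and4P: Q2 => _ _; rewrite eq_sym.
rewrite /nbrs -(card_in_imset finj); apply: subset_leq_card; apply/fintype.subsetP => v.
case/imsetP => s'; rewrite inE => /andP[s'T Q] ->.
by apply: (link_heavy _ (fP _ Q)); move: s'T; rewrite inE.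
Qed.

(** The links to [s1] and [s2] are distinct and heavy, so they exhaust [heavy s]. *)
Lemma heavy_link s s1 s2 v : quotient_edge s s1 -> quotient_edge s s2 -> s1 != s2 ->
  v \in heavy s -> link s v s1 || link s v s2.
Proof.
move=> Q1 Q2 s12 vh; have [sT s1T ss1 _] := and4P Q1; have [_ s2T ss2 _] := and4P Q2.
have [v1 l1] := quotient_link Q1; have [v2 l2] := quotient_link Q2.
apply: contraT; rewrite negb_or => /andP[n1 n2]; exfalso.
apply: (@heavy3 _ _ adjC adjI deg3 T Topt s v v1 v2) => //;
  [| exact: link_heavy l1| exact: link_heavy l2].
have vv1 : v != v1 by apply: contraNneq n1 => ->.
have vv2 : v != v2 by apply: contraNneq n2 => ->.
rewrite /= !inE negb_or vv1 vv2 /= andbT; apply: contraNneq s12 => E.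
by apply/eqP; apply: (@link_inj s v1) => //; rewrite ?E // eq_sym.
Qed.

(** The closing edge joins [x] and [last x p]. *)
Definition good_cut (c : seq V) : Prop :=
  if c is x :: p then adj x (last x p) \/ {in c &, forall v w, ~~ adj v w} else True.

(** If [v] and [w] on the cycle are adjacent, [w] is heavy for [v], hence a link to a cycle
    neighbour of [v]. Not being in [T], it is that neighbour, and the cycle can be cut there. *)
Lemma good_cut_exists c : uniq c -> cycle quotient_edge c -> 2 < size c ->
  {subset c <= ~: T} -> exists i, good_cut (rot i c).
Proof.
move=> cu cc c2 cT.
have cut v : v \in c -> adj v (next c v) -> exists i, good_cut (rot i c).
  move=> vc vn; have nc : next c v \in c by rewrite mem_next.
  have [i p Ep] := rot_to nc; exists i; rewrite Ep /=; left.
  have pu : uniq (next c v :: p) by rewrite -Ep rot_uniq.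
  have := last_head_cycle pu; rewrite -Ep next_rot // => /(congr1 (prev c)).
  by rewrite !prev_next // => ->; rewrite adjC.
have [/existsP[v /existsP[w /and3P[vc wc vw]]]|noadj] :=
  boolP [exists v, exists w, [&& v \in c, w \in c & adj v w]]; last first.
  exists 0; rewrite rot0; case: c noadj {cu cc c2 cT cut} => //= x p noadj; right => v w vc wc.
  apply: contra noadj => vw; apply/existsP; exists v; apply/existsP; exists w.
  by rewrite vc wc.
have [nc pc np vn vp] := cycle_two_nbrs quotient_edgeC cu cc c2 vc.
have inT x : x \in c -> x \notin T by move/cT; rewrite inE.
have vh : w \in heavy v by rewrite inE vw inT.
have /orP[/andP[_ l]|/andP[_ l]] := heavy_link vn vp np vh.
  apply: (cut v vc); case/orP: l => [/eqP<- //|/andP[/andP[wT _] _]].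
  by move: (inT _ wc); rewrite wT.
apply: (cut w wc); case/orP: l => [/eqP E|/andP[/andP[wT _] _]]; last first.
  by move: (inT _ wc); rewrite wT.
by rewrite {2}E next_prev // adjC.
Qed.

Section Levels.
Context (k : V -> nat).
Hypothesis klayout : layout quotient_edge good_cut (~: T) k.

Local Notation Q := quotient_edge.

Lemma k_inj s s' : s \notin T -> s' \notin T -> k s = k s' -> s = s'.
Proof. by case: klayout => kinj _ _ sT s'T; apply: kinj; rewrite inE. Qed.

Lemma k_lt s : s \notin T -> k s < #|V|.
Proof.
case: klayout => _ kb _ sT; apply: leq_trans (kb s _) (max_card _).
by rewrite inE.
Qed.

(* The levels between [a] and [b] make up a whole cycle of [Q], cut at [ab]. *)
Definition cyclic_range (a b : V) : Prop :=
  forall s, s \notin T -> k a <= k s <= k b ->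
  [/\ forall s', Q s s' -> k a <= k s' <= k b,
      exists s1 s2, [/\ s1 != s2, Q s s1 & Q s s2],
      adj a b \/ (forall s', s' \notin T -> ~~ adj s s')
    & forall s', Q s s' -> k s < k s' -> k s' = (k s).+1 \/ s = a /\ s' = b].

Lemma quotient_levels a b : Q a b -> k a < k b -> k b = (k a).+1 \/ cyclic_range a b.
Proof.
move=> ab kab; have [aT bT _ _] := and4P ab.
case: klayout => _ _ /(_ a b); rewrite !inE => /(_ aT bT ab kab) [->|]; first by left.
case=> c [[[gc cu cc c2] [a0 blast]] cT cclosed crange cedge]; right => s sT srange.
have sc : s \in c by rewrite crange ?inE.
have Qc s' : Q s s' -> s' \in c.
  by move=> ss'; apply: (cclosed s) => //; case/and4P: ss' => _; rewrite inE.
have inT x : x \in c -> x \notin T by move/cT; rewrite inE.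
split.
- by move=> s' /Qc s'c; rewrite -crange // inE inT.
- have [nc pc np sn sp] := cycle_two_nbrs quotient_edgeC cu cc c2 sc.
  by exists (next c s), (prev c s).
- case: c gc cu cc c2 a0 blast cT cclosed crange cedge sc Qc inT =>
  // x p gc cu cc c2 a0 blast cT cclosed crange cedge sc Qc inT.
  have ac : a \in x :: p by rewrite crange ?inE // leqnn ltnW.
  have bc : b \in x :: p by rewrite crange ?inE // leqnn ltnW.
  have ax : x = a by have := nth_index x ac; rewrite a0.
  have bx : last x p = b by have := nth_index x bc; rewrite blast (last_nth x).
  case: gc => [|noadj]; first by rewrite bx ax; left.
  right => s' s'T; apply/negP => ss'.
  have s'c : s' \in x :: p.
    apply: Qc; rewrite /Q sT s'T ss' /= andbT; apply: contraTneq ss' => ->.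
    by rewrite adjI.
  by move/negP: (noadj s s' sc s'c).
- by move=> s' ss'; apply: cedge => //; apply: Qc.
Qed.

(** * Levels and anchors *)

Local Notation n := #|V|.
(** Between consecutive levels there is room for the anchors, at offsets 1 to [n], and for the
    offset [n.+1]. The factor [j.+1] keeps the values up to [n] free for isolated vertices. *)
Definition level (j : nat) : nat := n.+2 * j.+1.

Lemma level_gap i j : i < j -> level i + n.+2 <= level j.
Proof. by rewrite /level => ij; rewrite addnC -mulnS leq_mul2l ltnS ij orbT. Qed.

Lemma leq_level i j : i <= j -> level i <= level j.
Proof. by rewrite /level => ij; rewrite leq_mul2l ltnS ij orbT. Qed.

Lemma ltn_level i j : (level i < level j) = (i < j).
Proof. by rewrite /level ltn_mul2l. Qed.

Lemma level_gt j : n < level j.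
Proof. by rewrite /level mulnS; apply: leq_trans (leq_addr _ _); rewrite ltnS. Qed.

Definition S_nbr (t : V) : pred V := fun s => (s \notin T) && adj t s.
Definition T_nbr (v : V) : pred V := fun t => (t \in T) && adj v t.

(* [low t] is [#|V|], above all levels of [S], if [t] has no neighbour in [S]. *)
Definition low (t : V) : nat := min_with n (S_nbr t) k.
Definition high (t : V) : nat := max_with (low t) (S_nbr t) k.
(** The rank makes anchors distinct, so that they order the vertices of a cycle of [T] strictly. *)
Definition anchor (t : V) : nat := level (low t) + (enum_rank t).+1.

Lemma rank_lt (v : V) : enum_rank v < n.
Proof. exact: ltn_ord. Qed.

Lemma rank_inj (v w : V) : enum_rank v = enum_rank w :> nat -> v = w.
Proof. by move=> /val_inj/enum_rank_inj. Qed.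

Lemma anchor_bounds t : level (low t) < anchor t <= level (low t) + n.
Proof. by rewrite /anchor; have := rank_lt t; clear; lia. Qed.

Lemma anchor_inj t t' : anchor t = anchor t' -> t = t'.
Proof.
move=> E; have := anchor_bounds t; have := anchor_bounds t'.
have [lt|lt|eql] := ltngtP (low t) (low t').
- by have := level_gap lt; rewrite E; clear; lia.
- by have := level_gap lt; rewrite E; clear; lia.
- by move=> _ _; apply: rank_inj; move: E; rewrite /anchor eql => /addnI [].
Qed.

Lemma low_le_high t : low t <= high t.
Proof. by case: (max_withP (low t) (S_nbr t) k). Qed.

Lemma low_high_range t s : s \notin T -> adj t s -> low t <= k s <= high t.
Proof.
move=> sT ts; have ss : S_nbr t s by rewrite /S_nbr sT.
case: (min_withP n (S_nbr t) k) => _ /(_ s ss) le1 _.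
by case: (max_withP (low t) (S_nbr t) k) => _ /(_ s ss) le2 _; apply/andP.
Qed.

Lemma low_high_cases t :
  (low t = n /\ high t = n) \/
  exists s0 s1, [/\ s0 \notin T, s1 \notin T, adj t s0, adj t s1 & k s0 = low t /\ k s1 = high t].
Proof.
have [_ _ low_n] := min_withP n (S_nbr t) k.
have [_ _ high_n] := max_withP (low t) (S_nbr t) k.
rewrite -/(low t) -/(high t) in low_n high_n.
case: low_n => [E|[s0 /andP[s0T ts0] E]]; case: high_n => [E'|[s1 /andP[s1T ts1] E']].
- by left; rewrite E' E.
- by exfalso; have := low_high_range s1T ts1; rewrite E; have := k_lt s1T; clear; lia.
- by right; exists s0, s0; split=> //; rewrite E' E.
- by right; exists s0, s1.
Qed.

(** Having a neighbour in [T], [t] has at most two outside, and these sit at its extreme levels. *)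
Lemma adj_level t s : t \in T -> 0 < deg T t -> s \notin T ->
  adj t s = (k s == low t) || (k s == high t).
Proof.
move=> tT t0 sT; case: (low_high_cases t) => [[El Eh]|[s0 [s1 [s0T s1T ts0 ts1 [E0 E1]]]]].
  rewrite El Eh; have -> : (k s == n) = false by apply/negbTE; rewrite neq_ltn (k_lt sT).
  by apply/negP => ts; have := low_high_range sT ts; have := k_lt sT; rewrite El; clear; lia.
rewrite -E0 -E1; apply/idP/idP => [ts|/orP[]/eqP/k_inj ->] //.
have [s01|s01] := eqVneq s0 s1.
  have := low_high_range sT ts; rewrite -E0 -E1 s01 => /andP[le1 le2].
  by rewrite eqn_leq le1 le2.
have := nbrs_compl deg3 T t => t3.
have : deg (~: T) t <= 2 by move: t3 t0; clear; lia.
apply: contraLR; rewrite negb_or -ltnNge => /andP[ne0 ne1].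
have u : uniq [:: s; s0; s1].
  have ss0 : s != s0 by apply/eqP => E; move: ne0; rewrite E eqxx.
  have ss1 : s != s1 by apply/eqP => E; move: ne1; rewrite E eqxx.
  by rewrite /= !inE negb_or s01 ss0 ss1.
by apply: (uniq_leq_card u) => w; rewrite !inE => /or3P[]/eqP->; apply/andP.
Qed.

Lemma inner_high t : t \in T -> deg T t = 2 -> high t = low t.
Proof.
move=> tT t2; case: (low_high_cases t) => [[-> ->] //|[s0 [s1 [s0T s1T ts0 ts1 [<- <-]]]]].
congr k; apply/eqP; apply: contraT => s10.
have := nbrs_compl deg3 T t; rewrite t2 leqNgt ltnS => /negP[].
have u : uniq [:: s1; s0] by rewrite /= inE s10.
by apply: (uniq_leq_card u) => w; rewrite !inE => /orP[]/eqP->; apply/andP.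
Qed.

Lemma high_gap t : t \in T -> 0 < deg T t -> low t < high t ->
  exists a b, [/\ a \notin T, b \notin T, adj t a, adj t b & [/\ k a = low t, k b = high t &
    Q a b]].
Proof.
move=> tT t0 lh; case: (low_high_cases t) => [[El Eh]|[a [b [aT bT ta tb [Ea Eb]]]]].
  by move: lh; rewrite El Eh ltnn.
exists a, b; split=> //; split=> //; rewrite /Q aT bT /=; apply/andP; split.
  by apply/eqP => ab; move: lh; rewrite -Ea -Eb ab ltnn.
apply/orP; right; apply/existsP; exists t; rewrite ta tb /path_end tT !andbT /=.
have := T_nbrs_le2 tT; rewrite leq_eqVlt => /orP[/eqP/(inner_high tT) E|];
  last by rewrite ltnS eqn_leq => ->.
by move: lh; rewrite E ltnn.
Qed.

(** A link from [s] to [s2] is a heavy neighbour different from [u] and [v], so only one place in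
    [heavy s] remains. *)
Lemma link_unique s s1 s2 u v : Q s s1 -> Q s s2 -> s1 != s2 ->
  link s u s1 -> link s v s1 -> u = v.
Proof.
move=> Q1 Q2 s12 lu lv; have [sT s1T ss1 _] := and4P Q1; have [_ s2T ss2 _] := and4P Q2.
have [w lw] := quotient_link Q2; apply/eqP; apply: contraT => uv; exfalso.
apply: (@heavy3 _ _ adjC adjI deg3 T Topt s u v w) => //;
  [| exact: link_heavy lu| exact: link_heavy lv| exact: link_heavy lw].
have ne x : link s x s1 -> x != w.
  move=> lx; apply: contraNneq s12 => E; apply/eqP; rewrite E in lx.
  by apply: link_inj lx lw => //; rewrite eq_sym.
by rewrite /= !inE negb_or uv !ne.
Qed.

Lemma cyclic_range_other a b : a \notin T -> k a < k b -> cyclic_range a b ->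
  exists2 c, Q a c & b != c.
Proof.
move=> aT kab /(_ a aT); rewrite leqnn ltnW // => /(_ isT) [_ [s1 [s2 [s12 Q1 Q2]]] _ _].
have [E|ne] := eqVneq b s1; last by exists s1.
by exists s2; rewrite // E.
Qed.

(** On a cycle the two links of [s] exhaust [heavy s]; an isolated vertex is heavy but links
    nothing. *)
Lemma cyclic_range_isolated a b s w : cyclic_range a b -> s \notin T -> k a <= k s <= k b ->
  w \in isolated -> ~~ adj s w.
Proof.
move=> ab sT srange; rewrite inE => /andP[wT w0]; apply/negP => sw.
have [_ [s1 [s2 [s12 Q1 Q2]]] _ _] := ab s sT srange.
have wh : w \in heavy s by rewrite inE sw (eqP w0) orbT.
have notlink x : Q s x -> ~~ link s w x.
  case/and4P => _ xT _ _; rewrite /link negb_and; apply/orP; right.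
  rewrite negb_or /path_end (eqP w0) andbF andbT.
  by apply: contraNneq xT => <-.
by have := heavy_link Q1 Q2 s12 wh; rewrite (negbTE (notlink _ Q1)) (negbTE (notlink _ Q2)).
Qed.

(** * Vertices of [T] that close a cycle *)

(* The vertices of [T] that close a cycle of [Q]; no edge inside [S] lies on such a cycle. *)
Definition long_end (u : V) : bool := path_end u && ((low u).+1 < high u).

Lemma long_endP u : long_end u ->
  exists a b, [/\ [/\ a \notin T, b \notin T, adj u a & adj u b], k a = low u, k b = high u,
    Q a b & cyclic_range a b].
Proof.
case/andP => u1 lh; have [uT /eqP n1] := andP u1.
have [|//||a [b [aT bT ua ub [Ea Eb ab]]]] := @high_gap u; rewrite ?n1 //; first exact: ltnW.
have kab : k a < k b by rewrite Ea Eb ltnW.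
by exists a, b; split=> //; case: (quotient_levels ab kab) => // E; move: lh;
  rewrite -Ea -Eb E ltnn.
Qed.

Lemma link_end a u b : path_end u -> adj u a -> adj u b -> link a u b.
Proof. by move=> u1 ua ub; rewrite /link adjC ua u1 ub orbT. Qed.

(** If the closing pair [a], [b] were adjacent, both [u] and [b] would link [a] to [b]. So the cut
    is not at an edge inside [S], which [good_cut] allows only when the cycle has no such edge. *)
Lemma long_end_noadj u s s' : long_end u -> s \notin T -> low u <= k s <= high u ->
  s' \notin T -> ~~ adj s s'.
Proof.
move=> ul sT srange s'T; have [u1 lh] := andP ul.
have [a [b [[aT bT ua ub] Ea Eb ab range_ab]]] := long_endP ul.
have kab : k a < k b by rewrite Ea Eb; apply: ltnW.
have := range_ab s sT; rewrite Ea Eb => /(_ srange) [_ _ [adj_ab|-> //] _].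
have [c ac bc] := cyclic_range_other aT kab range_ab.
have E : u = b.
  by apply: (link_unique ab ac bc); [exact: link_end|rewrite /link adj_ab eqxx].
by move: bT; rewrite -E; case/andP: u1 => ->.
Qed.

(** Long ends on the same cycle link the same closing pair, and the link is unique. *)
Lemma long_end_same u u' : long_end u -> long_end u' -> low u <= low u' <= high u -> u' = u.
Proof.
move=> ul ul' r; have [u1 lh] := andP ul; have [u1' lh'] := andP ul'.
have [a [b [[aT bT ua ub] Ea Eb ab range_ab]]] := long_endP ul.
have [a' [b' [[aT' bT' ua' ub'] Ea' Eb' ab' _]]] := long_endP ul'.
have kab : k a < k b by rewrite Ea Eb; apply: ltnW.
have := range_ab a' aT'; rewrite Ea Eb Ea' => /(_ r) [_ _ _ /(_ b' ab')].
rewrite Eb' => /(_ (ltnW lh')) [E|[Eaa Ebb]]; first by move: lh'; rewrite E ltnn.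
have [c ac bc] := cyclic_range_other aT kab range_ab.
rewrite Eaa in ua'; rewrite Ebb in ub'.
by apply: (link_unique ab ac bc); apply: link_end.
Qed.

(* A long end is kept short in the coordinate in which its T-neighbour does not force it to be
   long: up-ends are points in the third coordinate, down-ends in the second. *)
Definition has_lower (u : V) : bool := [exists t, T_nbr u t && (low t < low u)].
Definition up_end (u : V) : bool := long_end u && ~~ has_lower u.
Definition down_end (u : V) : bool := long_end u && has_lower u.

(** Pairs of [S] across which a vertex of [S] must stretch in one coordinate; [p] selects the long
    ends kept short there, which cannot bridge the gap themselves. *)
Definition joined (p : pred V) (a b : V) : bool :=
  [&& a \notin T, b \notin T, k a < k b & adj a b || [exists u, [&& p u, adj u a & adj u b]]].

Section Joined.
Context (p : pred V).
Hypothesis p_long : forall u, p u -> long_end u.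

Lemma joinedP a b : joined p a b ->
  adj a b \/ exists u, [/\ p u, low u = k a & high u = k b].
Proof.
case/and4P => aT bT kab /orP[|/existsP[u /and3P[pu ua ub]]]; first by left.
right; exists u; split=> //.
all: have /andP[/andP[uT /eqP u1] _] := p_long pu.
all: move: ua ub; rewrite !adj_level ?u1 // => /orP[]/eqP Ea /orP[]/eqP Eb //.
all: move: kab; rewrite Ea Eb ?ltnn //.
all: by have := low_le_high u; clear; lia.
Qed.

Lemma joined_quotient a b : joined p a b -> Q a b.
Proof.
case/and4P => aT bT kab ab; rewrite /Q aT bT /=; apply/andP; split.
  by apply: contraTneq kab => ->; rewrite ltnn.
case/orP: ab => [->//|/existsP[u /and3P[/p_long/andP[u1 _] ua ub]]].
by apply/orP; right; apply/existsP; exists u; rewrite u1 ua.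
Qed.

(** No edge inside [S] lies on the cycle of [u], so a pair touching it comes from a long end, namely
    [u]. *)
Lemma joined_long u a b : long_end u -> joined p a b ->
  low u <= k a <= high u \/ low u <= k b <= high u -> [/\ p u, k a = low u & k b = high u].
Proof.
move=> ul jab r; have [aT bT kab _] := and4P jab; have Qab := joined_quotient jab.
have ra : low u <= k a <= high u.
  case: r => // rb; have [a' [b' [[aT' bT' ua ub] Ea Eb ab range_ab]]] := long_endP ul.
  have := range_ab b bT; rewrite Ea Eb => /(_ rb) [h _ _ _].
  by apply: h; rewrite quotient_edgeC.
case: (joinedP jab) => [ab|[u' [pu' El Eh]]].
  by move/negP: (long_end_noadj ul aT ra bT).
have E : u' = u by apply: long_end_same => //; [exact: p_long|rewrite El].
by rewrite -E El Eh.
Qed.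
End Joined.

Lemma path_end_T_nbr u t t' : path_end u -> T_nbr u t -> T_nbr u t' -> t = t'.
Proof.
case/andP => uT /eqP u1 /andP[tT ut] /andP[tT' ut']; apply/eqP; apply: contraT => tt'.
have : 2 <= deg T u.
  have uq : uniq [:: t; t'] by rewrite /= inE tt'.
  by apply: (uniq_leq_card uq) => w; rewrite !inE => /orP[]/eqP->; apply/andP.
by rewrite u1.
Qed.

(** The neighbour [s0] of [t] at level [low t] lies on the cycle of [u], where all links are path
    ends. If [t] had T-degree 2, [inner_of_two_ends] would give [u] T-degree 2. A higher neighbour
    of [t] is joined to [s0] in the quotient graph, hence on the same cycle. *)
Lemma long_end_T_nbr u t : long_end u -> T_nbr u t -> low u <= low t <= high u ->
  deg T t = 1 /\ high t <= high u.
Proof.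
move=> ul /andP[tT ut] r; have [a [b [[aT bT ua ub] Ea Eb ab range_ab]]] := long_endP ul.
have [/andP[uT /eqP u1] _] := andP ul.
have t0 : 0 < deg T t by apply: (nbrs_gt0 uT); rewrite adjC.
case: (low_high_cases t) => [[El Eh]|[s0 [s1 [s0T s1T ts0 ts1 [E0 E1]]]]].
  by move: r; rewrite El -Eb; have := k_lt bT; clear; lia.
have := range_ab s0 s0T; rewrite Ea Eb E0 => /(_ r) [closed [x [y [xy Qx Qy]]] _ _].
split.
  have := T_nbrs_le2 tT; rewrite leq_eqVlt => /orP[/eqP t2|]; last by move: t0; clear; lia.
  have end_link z : Q s0 z -> exists v, [/\ v \in T, deg T v = 1, adj s0 v & link s0 v z].
    move=> Qz; have [v l] := quotient_link Qz; exists v;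
      have /andP[sv /orP[/eqP Ez|/andP[/andP[vT /eqP v1] _]]] := l; last by [].
    exfalso; have zT : z \notin T by case/and4P: Qz.
    by move: sv; apply/negP; rewrite Ez; apply: (long_end_noadj ul) => //; rewrite E0.
  have [v1 [v1T n1 sv1 l1]] := end_link x Qx; have [v2 [v2T n2 sv2 l2]] := end_link y Qy.
  have v12 : v1 != v2.
    have [_ xT sx _] := and4P Qx; have [_ yT sy _] := and4P Qy.
    apply: contraNneq xy => E; rewrite -E in l2; apply/eqP.
    by apply: link_inj l1 l2 => //; rewrite eq_sym.
  have := @inner_of_two_ends _ _ adjC adjI deg3 T Topt s0 v1 v2 t u s0T v12.
  rewrite n1 n2 u1 => /(_ v1T isT sv1 v2T isT sv2 tT t2).
  by rewrite adjC => /(_ ts0 uT); rewrite adjC => /(_ ut).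
have [E|lh] := eqVneq (low t) (high t); first by rewrite -E; case/andP: r.
have {}lh : low t < high t by rewrite ltn_neqAle lh low_le_high.
have [a' [b' [aT' bT' _ _ [Ea' Eb' Qab']]]] := high_gap tT t0 lh.
have Es : a' = s0 by apply: k_inj => //; rewrite Ea' E0.
by have := closed b'; rewrite -Es => /(_ Qab') /andP[_]; rewrite Eb'.
Qed.

Lemma up_long u : up_end u -> long_end u. Proof. by case/andP. Qed.
Lemma down_long u : down_end u -> long_end u. Proof. by case/andP. Qed.

Definition good_start (c : seq V) : Prop :=
  if c is x :: p then {in c, forall v, anchor x <= anchor v} else True.

Lemma good_start_exists c : 2 < size c -> exists i, good_start (rot i c).
Proof.
case: c => // x0 p0; set c := x0 :: p0 => _; have x0c : x0 \in c by rewrite inE eqxx.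
case: (arg_minnP anchor x0c) => x xc xmin; have [i p Ep] := rot_to xc.
by exists i; rewrite Ep => v; rewrite -Ep mem_rot => vc; apply: xmin.
Qed.

(** * Coordinates *)

Section Coordinates.
Context (pos : V -> nat).
Hypothesis playout : layout adj good_start T pos.

(** Lies beyond all other coordinates, including those at level [n], the default of [low]. *)
Definition top : nat := level n.+1 + n.+2.

Definition iso_nbr (s : V) : pred V := fun w => (w \in isolated) && adj s w.

(** The values 1 to [n] hold the isolated vertices; the paths and cycles of [T] start at [n.+1]. A
    vertex of [S] goes below [n.+1] only to reach an isolated neighbour. *)
Definition xlo v :=
  if v \in T then if v \in isolated then n - enum_rank v else n.+1 + pos v
  else min_with n.+1 (iso_nbr v) (fun w => n - enum_rank w).
Definition xhi v :=
  if v \in T then if v \in isolated then n - enum_rank v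
                  else n.+1 + max_with (pos v) (T_nbr v) pos
  else top.
Definition ylo v :=
  if v \in T then if v \in isolated then enum_rank v : nat else level (low v)
  else min_with (min_with (level (k v)) (fun a => joined down_end a v) (fun a => level (k a)))
         (iso_nbr v) (fun w => enum_rank w).
Definition yhi v :=
  if v \in T then if v \in isolated then enum_rank v : nat
                  else if down_end v then level (low v)
                  else max_with (level (high v)) (T_nbr v) (fun t => level (low t))
  else level (k v).
Definition zlo v :=
  if v \in T then if v \in isolated then 0
                  else if up_end v then level (high v)
                  else min_with (anchor v) (T_nbr v) anchor
  else level (k v).
(** An up-end [u] starts only at [level (high u)], so its T-neighbours must reach up to it; when
    [low v] exceeds [high u], the anchor of [v] already does. *)
Definition zhi v :=
  if v \in T then if v \in isolated then top
                  else max_with (maxn (anchor v) (level (high v)))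
                         (fun u => [&& T_nbr v u, up_end u & low v <= high u])
                         (fun u => level (high u))
  else max_with (level (k v) + n.+1) (fun b => joined up_end v b) (fun b => level (k b)).

(** One-sided tests: boxes intersect if [meet] holds both ways, are disjoint if [left_of] holds one
    way, and share at most boundary points if [abuts] holds one way. *)
Definition meet u v := [&& xlo u <= xhi v, ylo u <= yhi v & zlo u <= zhi v].
Definition left_of u v := [|| xhi u < xlo v, yhi u < ylo v | zhi u < zlo v].
Definition abuts u v := [|| xhi u <= xlo v, yhi u <= ylo v | zhi u <= zlo v].

Definition nonisolated t := (t \in T) && (t \notin isolated).

Lemma nonisolatedP t : nonisolated t -> t \in T /\ 0 < deg T t.
Proof. by case/andP => tT; rewrite inE tT /= lt0n. Qed.

Lemma T_coords t : nonisolated t ->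
  [/\ xlo t = n.+1 + pos t, xhi t = n.+1 + max_with (pos t) (T_nbr t) pos,
      ylo t = level (low t) &
  [/\ yhi t = (if down_end t then level (low t)
                  else max_with (level (high t)) (T_nbr t) (fun t => level (low t))),
      zlo t = (if up_end t then level (high t) else min_with (anchor t) (T_nbr t) anchor) &
      zhi t = max_with (maxn (anchor t) (level (high t)))
                         (fun u => [&& T_nbr t u, up_end u & low t <= high u])
                         (fun u => level (high u))]].
Proof. by case/andP => tT /negbTE ti; rewrite /xlo /xhi /ylo /yhi /zlo /zhi tT ti. Qed.

Lemma S_coords s : s \notin T ->
  [/\ xhi s = top, yhi s = level (k s) & zlo s = level (k s)].
Proof. by move=> /negbTE sT; rewrite /xhi /yhi /zlo sT. Qed.

Lemma xlo_S s : s \notin T ->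
  [/\ xlo s <= n.+1, forall w, iso_nbr s w -> xlo s <= n - enum_rank w
    & xlo s = n.+1 \/ exists2 w, iso_nbr s w & xlo s = n - enum_rank w].
Proof. by move=> /negbTE sT; rewrite /xlo sT; apply: min_withP. Qed.

Lemma ylo_S s : s \notin T ->
  [/\ ylo s <= level (k s), forall a, joined down_end a s -> ylo s <= level (k a),
      forall w, iso_nbr s w -> ylo s <= enum_rank w
    & [\/ ylo s = level (k s), exists2 a, joined down_end a s & ylo s = level (k a)
        | exists2 w, iso_nbr s w & ylo s = enum_rank w]].
Proof.
move=> /negbTE sT; rewrite /ylo sT; set m := min_with (level _) _ _.
case: (min_withP m (iso_nbr s) (fun w => enum_rank w)) => le1 le2 eq1.
have [le3 le4 eq2] := min_withP (level (k s)) (fun a => joined down_end a s) (fun a =>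
  level (k a)).
rewrite -/m in le3 le4 eq2.
split=> [|a ja||]; [exact: leq_trans le1 le3| exact: leq_trans le1 (le4 _ ja)| exact: le2|].
case: eq1 => [->|[w sw E]]; last by constructor 3; exists w.
by case: eq2 => [->|[a ja E]]; [constructor 1|constructor 2; exists a].
Qed.

Lemma zhi_S s : s \notin T ->
  [/\ level (k s) + n.+1 <= zhi s, forall b, joined up_end s b -> level (k b) <= zhi s
    & zhi s = level (k s) + n.+1 \/ exists2 b, joined up_end s b & zhi s = level (k b)].
Proof. by move=> /negbTE sT; rewrite /zhi sT; apply: max_withP. Qed.

Lemma zhi_T t : nonisolated t ->
  [/\ anchor t <= zhi t, level (high t) <= zhi t,
      forall u, T_nbr t u -> up_end u -> low t <= high u -> level (high u) <= zhi t
    & zhi t <= maxn (anchor t) (level (high t)) \/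
      exists u, [/\ T_nbr t u, up_end u, low t <= high u & zhi t = level (high u)]].
Proof.
move=> tT; have [_ _ _ [_ _ ->]] := T_coords tT; set m := max_with _ _ _.
have [le1 le2 eq1] := max_withP (maxn (anchor t) (level (high t)))
  (fun u => [&& T_nbr t u, up_end u & low t <= high u]) (fun u => level (high u)).
rewrite -/m in le1 le2 eq1.
split; [exact: leq_trans (leq_maxl _ _) le1|exact: leq_trans (leq_maxr _ _) le1| |].
  by move=> u tu uu lu; apply: le2; rewrite tu uu.
by case: eq1 => [->|[u /and3P[tu uu lu] E]]; [left|right; exists u].
Qed.

Lemma pos_inj t t' : t \in T -> t' \in T -> pos t = pos t' -> t = t'.
Proof. by case: playout => pinj _ _; apply: pinj. Qed.

Lemma pos_lt t : t \in T -> pos t < n.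
Proof. by case: playout => _ pb _ tT; apply: leq_trans (pb t tT) (max_card _). Qed.

Lemma n_lt_top : n.*2 < top /\ forall j, j <= n -> level j + n.+2 <= top.
Proof.
split; first by rewrite /top; have := level_gt n.+1; clear; lia.
move=> j jn; rewrite /top leq_add2r; apply: leq_level; exact: leqW.
Qed.

Lemma lo_le_hi v : meet v v.
Proof.
have [vT|vT] := boolP (v \in T); last first.
  have [xh yh zl] := S_coords vT; rewrite /meet xh yh zl.
  have [le1 _ _] := xlo_S vT; have [-> _ _ _] := ylo_S vT; have [le2 _ _] := zhi_S vT.
  have [tp _] := n_lt_top.
  apply/and3P; split=> //; first by move: le1 tp; clear; lia.
  exact: leq_trans (leq_addr _ _) le2.
have [vi|vi] := boolP (v \in isolated).
  by rewrite /meet /xlo /xhi /ylo /yhi /zlo /zhi vT vi !leqnn.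
have vt : nonisolated v by rewrite /nonisolated vT.
rewrite /meet; have [-> -> -> [-> -> _]] := T_coords vt.
case: (max_withP (pos v) (T_nbr v) pos) => le1 _ _.
case: (max_withP (level (high v)) (T_nbr v) (fun t => level (low t))) => le2 _ _.
case: (min_withP (anchor v) (T_nbr v) anchor) => le3 _ _.
have [le4 le5 _ _] := zhi_T vt.
apply/and3P; split; first by rewrite leq_add2l.
  case: ifP => // _; exact: leq_trans (leq_level (low_le_high v)) le2.
by case: ifP => // _; apply: leq_trans le3 le4.
Qed.

(** * Isolated vertices *)

Lemma isolated_coords w : w \in isolated ->
  [/\ xlo w = n - enum_rank w, xhi w = n - enum_rank w, ylo w = enum_rank w
    & [/\ yhi w = enum_rank w, zlo w = 0 & zhi w = top]].
Proof.
move=> wi; have wT : w \in T by move: wi; rewrite inE => /andP[].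
by rewrite /xlo /xhi /ylo /yhi /zlo /zhi wT wi.
Qed.

Lemma isolated_adjT w t : w \in isolated -> t \in T -> adj w t = false.
Proof.
rewrite inE => /andP[_ w0] tT; apply/negP => wt.
by have := nbrs_gt0 tT wt; rewrite (eqP w0).
Qed.

Lemma isolated_T w t : w \in isolated -> t \in T -> w != t -> left_of w t || left_of t w.
Proof.
move=> wi tT wt; have [xl xh _ _] := isolated_coords wi.
have [ti|ti] := boolP (t \in isolated).
  have [xl' xh' _ _] := isolated_coords ti; rewrite /left_of xl xh xl' xh'.
  have : (enum_rank w : nat) <> enum_rank t by move/rank_inj/eqP; rewrite (negbTE wt).
  have := rank_lt w; have := rank_lt t; clear; lia.
have tt : nonisolated t by rewrite /nonisolated tT.
have [xl' _ _ _] := T_coords tt; rewrite /left_of xh xl'.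
suff -> : n - enum_rank w < n.+1 + pos t by [].
by rewrite addSn ltnS; apply: leq_trans (leq_subr _ _) (leq_addr _ _).
Qed.

(** The boxes touch in the second coordinate, where [s] starts at the rank of its only isolated
    neighbour. *)
Lemma isolated_S_adj w s : w \in isolated -> s \notin T -> adj s w ->
  [/\ meet w s, meet s w & abuts w s].
Proof.
move=> wi sT sw; have [xl xh yl [yh zl zh]] := isolated_coords wi.
have sw' : iso_nbr s w by rewrite /iso_nbr wi.
have [xh' yh' zl'] := S_coords sT; have [_ /(_ w sw') xl' _] := xlo_S sT.
have [_ _ /(_ w sw') yl' yl''] := ylo_S sT; have [zh' _ _] := zhi_S sT.
have [tp1 tp2] := n_lt_top; have tp3 := tp2 _ (ltnW (k_lt sT)).
have rw := rank_lt w; have lv := level_gt (k s).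
rewrite /meet /abuts xl xh yl yh zl zh xh' yh' zl'; split.
- by apply/and3P; split=> //; move: tp1 rw lv; clear; lia.
- by apply/and3P; split=> //; move: tp3; clear; lia.
apply/or3P; constructor 2.
case: yl'' => [->|[a _ ->]|[w' /andP[wi' sw''] ->]].
- exact: ltnW (ltn_trans rw lv).
- exact: ltnW (ltn_trans rw (level_gt _)).
- by rewrite (isolated_nbr_unique adjC adjI deg3 Topt sT wi wi' sw sw'').
Qed.

(** If [s] reaches an isolated neighbour [w'], it starts at [n - enum_rank w'] in the first
    coordinate and at [enum_rank w'] in the second. The orders are opposite, so one of them leaves
    [w] out. *)
Lemma isolated_S_nonadj w s : w \in isolated -> s \notin T -> ~~ adj s w ->
  left_of w s || left_of s w.
Proof.
move=> wi sT sw; have [xl xh yl [yh zl zh]] := isolated_coords wi.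
have [_ _ xl'] := xlo_S sT; have [_ _ _ yl'] := ylo_S sT.
have rw := rank_lt w; rewrite /left_of xh yh.
case: yl' => [->|[a _ ->]|[w' /andP[wi' sw'] Ey]].
- by rewrite (ltn_trans rw (level_gt _)) !orbT.
- by rewrite (ltn_trans rw (level_gt _)) !orbT.
have ww : (enum_rank w : nat) <> enum_rank w'.
  by move/rank_inj => E; move: sw; rewrite E sw'.
have rw' := rank_lt w'; case: xl' => [->|[w'' /andP[wi'' sw''] ->]].
  by rewrite ltnS leq_subr.
rewrite (isolated_nbr_unique adjC adjI deg3 Topt sT wi'' wi' sw'' sw') Ey.
by move: ww rw rw'; clear; lia.
Qed.

(** * Pairs inside [T] *)

Lemma T_T_meet t t' : nonisolated t -> nonisolated t' -> adj t t' -> meet t t'.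
Proof.
move=> tT tT' tt'; have [t_T _] := nonisolatedP tT; have [t_T' _] := nonisolatedP tT'.
have nb : T_nbr t t' by rewrite /T_nbr t_T'.
have nb' : T_nbr t' t by rewrite /T_nbr t_T adjC.
rewrite /meet; have [-> _ -> [_ -> _]] := T_coords tT.
have [za zh zu _] := zhi_T tT'.
have [_ -> _ [-> _ _]] := T_coords tT'.
apply/and3P; split.
- by rewrite leq_add2l; case: (max_withP (pos t') (T_nbr t') pos) => _ /(_ t nb').
- case: ifP => [|_]; last first.
    by case: (max_withP (level (high t')) (T_nbr t') (fun t => level (low t))) => _ /(_ t nb').
  (* The only T-neighbour of a down-end has a smaller [low], so the short interval still
     suffices. *)
  case/andP => /andP[e' _] /existsP[t'' /andP[nb'' lt]].
  by rewrite (path_end_T_nbr e' nb' nb''); apply: leq_level; apply: ltnW.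
- case: ifP => [ut|_]; last first.
    by case: (min_withP (anchor t) (T_nbr t) anchor) => _ /(_ t' nb) le _; apply: leq_trans le za.
  have [le|lt] := leqP (low t') (high t); first exact: zu.
  apply: leq_trans za; have /andP[le _] := anchor_bounds t'.
  by apply: ltnW; apply: leq_ltn_trans le; apply: leq_level; apply: ltnW.
Qed.

(* A vertex that meets a later one other than its successor in the first coordinate starts a
   cycle, along which its anchor is smallest. *)
Lemma T_T_later t t' : nonisolated t -> nonisolated t' -> pos t < pos t' ->
  xlo t' < xhi t \/ ~~ adj t t' && (xlo t' <= xhi t) ->
  if adj t t' then zhi t <= zlo t' else zhi t < zlo t'.
Proof.
move=> tT tT' ptt'; have [t_T _] := nonisolatedP tT; have [t_T' _] := nonisolatedP tT'.
have [_ -> _ _] := T_coords tT; have [-> _ _ [_ -> _]] := T_coords tT'.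
rewrite !ltn_add2l !leq_add2l => over.
(* To reach so far, [t] needs a T-neighbour [t''] beyond [t']; that edge skips [t'] and so closes a
   cycle. *)
have [t'' [/andP[tT'' tt''] pt'']] : exists t'', T_nbr t t'' /\ pos t' < pos t''.
  case: (max_withP (pos t) (T_nbr t) pos) over => _ _ [->|[t'' nb ->]] over.
    by move: over ptt' => [|/andP[_]]; clear; lia.
  exists t''; split=> //; case: over => // /andP[tt' ]; rewrite leq_eqVlt => /orP[/eqP E|//].
  have [tT'' tt''] := andP nb.
  by move: tt'; rewrite (pos_inj t_T' tT'' E) tt''.
have lt : pos t < pos t'' by apply: ltn_trans ptt' pt''.
case: playout => _ _ /(_ t t'' t_T tT'' tt'' lt) [E|].
  by move: pt'' ptt'; rewrite E; clear; lia.
case=> c [[[gc cu cc c2] [t0 _]] cT cclosed crange cedge].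
have t'c : t' \in c by rewrite crange // (ltnW ptt') (ltnW pt'').
have tc : t \in c by rewrite crange // leqnn (ltnW lt).
have tmin v : v \in c -> anchor t <= anchor v.
  case: c gc cu cc c2 t0 cT cclosed crange cedge t'c tc => // x p gc _ _ _ t0 _ _ _ _ _ tc.
  have -> : t = x by have := nth_index x tc; rewrite t0.
  exact: gc.
have inner v : v \in c -> deg T v = 2.
  move=> vc; apply/eqP; rewrite eqn_leq T_nbrs_le2 ?cT //=.
  have [nc pc np vn vp] := cycle_two_nbrs adjC cu cc c2 vc.
  have u2 : uniq [:: next c v; prev c v] by rewrite /= inE np.
  by apply: (uniq_leq_card u2) => w; rewrite !inE => /orP[]/eqP->; rewrite ?vn ?vp cT.
have noend v : v \in c -> path_end v = false by move=> /inner vi; rewrite /path_end vi andbF.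
(* A cycle of [T] contains no path end, so nothing makes [t] reach above its anchor. *)
have ht : zhi t <= anchor t.
  have [_ _ _ [le|[u [/andP[uT tu] uu _ _]]]] := zhi_T tT.
    apply: leq_trans le _; rewrite geq_max leqnn inner_high ?inner //=.
    by have /andP[/ltnW] := anchor_bounds t.
  have uc : u \in c by apply: (cclosed t).
  by move: uu; rewrite /up_end /long_end noend.
rewrite /up_end /long_end noend //=.
case: (min_withP (anchor t') (T_nbr t') anchor) => _ _ lo'.
have le' : anchor t <= min_with (anchor t') (T_nbr t') anchor.
  case: lo' => [->|[v /andP[vT t'v] ->]]; apply: tmin => //.
  by apply: (cclosed t').
case: ifPn => [_|tt']; first exact: leq_trans ht le'.
apply: leq_ltn_trans ht _; rewrite ltn_neqAle le' andbT; apply/eqP.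
case: lo' => [->|[v /andP[vT t'v] ->]] /anchor_inj E.
  by move: ptt'; rewrite E ltnn.
by move: tt'; rewrite E adjC t'v.
Qed.

Lemma T_T_sep t t' : nonisolated t -> nonisolated t' -> pos t < pos t' ->
  if adj t t' then abuts t t' else left_of t t'.
Proof.
move=> tT tT' ptt'; have := T_T_later tT tT' ptt'; rewrite /abuts /left_of.
case: ifP => tt' /= h.
  by case: leqP => //= lt; rewrite (h (or_introl lt)) !orbT.
by case: ltnP => //= le; rewrite (h (or_intror le)) !orbT.
Qed.

(** * Pairs between [S] and [T] *)

Lemma joined_by (p : pred V) u a b : p u -> a \notin T -> b \notin T -> k a < k b ->
  adj u a -> adj u b ->
  joined p a b.
Proof.
move=> pu aT bT kab ua ub; rewrite /joined aT bT kab /=.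
by apply/orP; right; apply/existsP; exists u; rewrite pu ua.
Qed.

Lemma S_T_meet s t : s \notin T -> nonisolated t -> adj t s -> meet s t /\ meet t s.
Proof.
move=> sT tT ts; have [t_T t0] := nonisolatedP tT.
have [xh yh zl] := S_coords sT; have [xl _ _] := xlo_S sT.
have [yl yj _ _] := ylo_S sT; have [zh zj _] := zhi_S sT.
have [_ th _ _] := zhi_T tT.
have /orP lev : (k s == low t) || (k s == high t) by rewrite -adj_level.
have low_le : low t <= k s by case: lev => /eqP ->; rewrite ?low_le_high.
have high_ge : k s <= high t by case: lev => /eqP ->; rewrite ?low_le_high.
rewrite /meet xh yh zl; have [-> -> -> [-> -> _]] := T_coords tT.
have [tp1 _] := n_lt_top; have pt := pos_lt t_T.
case: (max_withP (level (high t)) (T_nbr t) (fun t => level (low t))) => le2 _ _.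
case: (min_withP (anchor t) (T_nbr t) anchor) => le3 _ _.
have long u : long_end u -> u = t -> exists a b, [/\ a \notin T, b \notin T, adj t a, adj t b
    & [/\ k a = low t, k b = high t & k a < k b]].
  move=> ul <-; have [a [b [[aT bT ua ub] Ea Eb _ _]]] := long_endP ul.
  by exists a, b; split=> //; split=> //; rewrite Ea Eb; apply: ltnW; case/andP: ul.
split; apply/and3P; split.
- by apply: leq_trans xl _; apply: leq_addr.
- case: ifP => [dt|_]; last by apply: leq_trans yl _; apply: leq_trans le2; apply: leq_level.
  (* A down-end stays at its lower level, so its neighbour [b] at the upper level must stretch down
     to it. *)
  have [a [b [aT bT ta tb [Ea Eb kab]]]] := long t (down_long dt) erefl.
  case: lev => /eqP E; first by rewrite -E.
  have Es : s = b by apply: k_inj => //; rewrite E Eb.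
  by rewrite -Ea; apply: yj; rewrite Es; apply: (@joined_by _ t).
- by apply: leq_trans th; apply: leq_level.
- by apply: ltnW; move: tp1 pt; clear; lia.
- exact: leq_level.
- case: ifP => [ut|_]; last first.
    apply: leq_trans le3 _; apply: leq_trans zh.
    have /andP[_ le] := anchor_bounds t; apply: leq_trans le _.
    by apply: leq_add; rewrite ?leqnSn // leq_level.
  have [a [b [aT bT ta tb [Ea Eb kab]]]] := long t (up_long ut) erefl.
  case: lev => /eqP E; last by rewrite -E; apply: leq_trans zh; apply: leq_addr.
  have Es : s = a by apply: k_inj => //; rewrite E Ea.
  by rewrite -Eb; apply: zj; rewrite Es; apply: (@joined_by _ t).
Qed.

(** On the cycle of [u] there are no isolated neighbours, and only the upper vertex of a pair closed
    by a down-end stretches down. *)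
Lemma ylo_long u s : long_end u -> s \notin T -> low u <= k s <= high u ->
  ~~ down_end u \/ k s < high u -> ylo s = level (k s).
Proof.
move=> ul sT r notdn; have [_ _ _ [//|[a ja _]|[w /andP[wi sw] _]]] := ylo_S sT.
  have [dn _ Eh] := joined_long down_long ul ja (or_intror r).
  by case: notdn; [rewrite dn|rewrite Eh ltnn].
have [a [b [[aT bT ua ub] Ea Eb _ range_ab]]] := long_endP ul.
by have := cyclic_range_isolated range_ab sT; rewrite Ea Eb => /(_ w r wi); rewrite sw.
Qed.

(* Beyond its S-neighbours, [t] reaches upwards in the third coordinate only towards an up-end whose
   cycle contains [t]; then [t] and the vertices of this cycle are short in the second one. *)
Lemma zhi_T_cases s t : s \notin T -> nonisolated t -> high t <= k s ->
  zhi t <= maxn (anchor t) (level (high t)) \/ zhi t < zlo s \/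
  yhi t <= level (high t) /\ ylo s = level (k s).
Proof.
move=> sT tT hs; have [t_T t0] := nonisolatedP tT; have [_ _ zl] := S_coords sT.
have [_ _ _ [|[u [nb uu lu ->]]]] := zhi_T tT; first by left.
right; have [lt|ks] := ltnP (high u) (k s); first by left; rewrite zl ltn_level.
right; have [uT tu] := andP nb; have [ul notlow] := andP uu.
have nb' : T_nbr u t by rewrite /T_nbr t_T adjC.
have low_ut : low u <= low t.
  rewrite leqNgt; apply: contra notlow => lt; apply/existsP; exists t; rewrite nb'; exact: lt.
have [t1 htu] : deg T t = 1 /\ high t <= high u.
  by apply: long_end_T_nbr => //; rewrite low_ut.
have te : path_end t by rewrite /path_end t_T t1.
split; last first.
  apply: (ylo_long ul) => //; last by left; rewrite /down_end ul (negbTE notlow).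
  by rewrite ks andbT (leq_trans low_ut) // (leq_trans (low_le_high t)).
have [_ _ _ [-> _ _]] := T_coords tT; case: ifP => _; first exact: leq_level (low_le_high t).
case: (max_withP (level (high t)) (T_nbr t) (fun t => level (low t))) => _ _ [->//|[v nv ->]].
rewrite (path_end_T_nbr te nv nb); apply: leq_level.
exact: leq_trans low_ut (low_le_high t).
Qed.

(** At the lower level of [t] the boxes touch in the second coordinate. At a higher one they touch
    in the third, unless [t] reaches on to an up-end; then the second serves again. *)
Lemma S_T_abuts s t : s \notin T -> nonisolated t -> adj t s -> abuts s t || abuts t s.
Proof.
move=> sT tT ts; have [t_T t0] := nonisolatedP tT.
have [_ yh zl] := S_coords sT; have [_ _ yl _] := T_coords tT; rewrite /abuts yh yl.
have : (k s == low t) || (k s == high t) by rewrite -adj_level.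
case/orP => /eqP E; first by rewrite E leqnn !orbT.
have [El|lt] := eqVneq (low t) (high t); first by rewrite E El leqnn !orbT.
have {}lt : low t < high t by rewrite ltn_neqAle lt low_le_high.
have /andP[_ an] := anchor_bounds t; have gap := level_gap lt.
have [|le|[lez|[le eqy]]] := zhi_T_cases sT tT; first by rewrite E.
- have -> : zhi t <= zlo s; last by rewrite !orbT.
  apply: leq_trans le _; rewrite zl E geq_max leqnn andbT.
  by move: an gap; clear; lia.
- by rewrite (ltnW lez) !orbT.
- by rewrite eqy E le !orbT.
Qed.

(** Below the levels of [t] the second coordinate separates; above them the third does, or again the
    second if [t] reaches on to an up-end. Strictly between them [t] is a long end, separated from
    [s] in the coordinate in which it is kept short. *)
Lemma S_T_sep s t : s \notin T -> nonisolated t -> ~~ adj t s -> left_of s t || left_of t s.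
Proof.
move=> sT tT; have [t_T t0] := nonisolatedP tT; rewrite adj_level // negb_or => /andP[ne1 ne2].
have [_ yh zl] := S_coords sT; have [_ _ yl _] := T_coords tT; rewrite /left_of yh yl zl.
have [lt|le] := ltnP (k s) (low t); first by rewrite ltn_level lt !orbT.
have {ne1}lt1 : low t < k s by rewrite ltn_neqAle eq_sym ne1.
have /andP[_ an] := anchor_bounds t; have gap := level_gap lt1.
have [lt2|] := ltnP (high t) (k s).
  have [|le'|[lez|[le' eqy]]] := zhi_T_cases sT tT; first exact: ltnW.
  - have -> : zhi t < level (k s); last by rewrite !orbT.
    apply: leq_ltn_trans le' _; rewrite gtn_max ltn_level lt2 andbT.
    by move: an gap; clear; lia.
  - by rewrite -zl lez !orbT.
  - have -> : yhi t < ylo s; last by rewrite !orbT.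
    by apply: leq_ltn_trans le' _; rewrite eqy ltn_level.
rewrite leq_eqVlt (negbTE ne2) /= => lt2.
have t1 : path_end t.
  rewrite /path_end t_T eqn_leq t0 andbT -ltnS ltn_neqAle T_nbrs_le2 // andbT.
  by apply/eqP => /(inner_high t_T) E; move: lt2; rewrite E ltnNge ltnW.
have tl : long_end t by rewrite /long_end t1 (leq_ltn_trans lt1 lt2).
have range : low t <= k s <= high t by rewrite (ltnW lt1) (ltnW lt2).
have [low_t|low_t] := boolP (has_lower t).
  have dt : down_end t by rewrite /down_end tl.
  have [_ _ _ [-> _ _]] := T_coords tT; rewrite dt.
  rewrite (ylo_long tl sT range); last by right.
  by rewrite [level (low t) < _]ltn_level lt1 !orbT.
have ut : up_end t by rewrite /up_end tl.
have [_ _ _ [_ -> _]] := T_coords tT; rewrite ut.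
have [_ _ [->|[b jb _]]] := zhi_S sT.
  have -> : level (k s) + n.+1 < level (high t); last by rewrite !orbT.
  by have := level_gap lt2; rewrite addnS.
have [_ El _] := joined_long up_long tl jb (or_introl range).
by move: lt1; rewrite El ltnn.
Qed.

(** * Pairs inside [S] *)

Lemma S_S_meet a b : a \notin T -> b \notin T -> k a < k b -> adj a b -> meet a b /\ meet b a.
Proof.
move=> aT bT kab ab; rewrite /meet.
have jab (p : pred V) : joined p a b by rewrite /joined aT bT kab ab.
have [-> -> ->] := S_coords aT; have [-> -> ->] := S_coords bT.
have [xa _ _] := xlo_S aT; have [xb _ _] := xlo_S bT; have [tp _] := n_lt_top.
have [ya _ _ _] := ylo_S aT; have [_ /(_ a (jab _)) yb _ _] := ylo_S bT.
have [_ /(_ b (jab _)) za _] := zhi_S aT; have [zb _ _] := zhi_S bT.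
have le := leq_level (ltnW kab).
split; apply/and3P; split=> //.
- by move: xa tp; clear; lia.
- exact: leq_trans ya le.
- by apply: leq_trans le _; apply: leq_trans zb; apply: leq_addr.
- by move: xb tp; clear; lia.
Qed.

(** The pair [a], [b'] closes a cycle containing [b], so [b] stretches down at most to level [k a].
    Reaching that level without an edge [ab] would take a down-end closing the pair [a], [b], but
    the closing pair of this cycle is [a], [b']. *)
Lemma S_S_crossing a b b' : a \notin T -> b \notin T -> k a < k b -> k b < k b' ->
  joined up_end a b' -> if adj a b then level (k a) <= ylo b else level (k a) < ylo b.
Proof.
move=> aT bT kab kbb' jab'; have Qab' := joined_quotient up_long jab'.
have [E|range_ab] := quotient_levels Qab' (ltn_trans kab kbb').
  by move: kab kbb'; rewrite E; clear; lia.
have range_b : k a <= k b <= k b' by rewrite (ltnW kab) (ltnW kbb').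
have [closed _ _ _] := range_ab b bT range_b.
have [_ _ _ [->|[a' ja' ->]|[w /andP[wi bw] _]]] := ylo_S bT.
- by case: ifP => _; [apply: leq_level; apply: ltnW|rewrite ltn_level].
- have [aT' _ ka'b _] := and4P ja'; have Qa'b := joined_quotient down_long ja'.
  have /andP[le _] : k a <= k a' <= k b' by apply: closed; rewrite quotient_edgeC.
  case: ifPn => nab; first exact: leq_level.
  rewrite ltn_level ltn_neqAle le andbT; apply/eqP => E.
  have Ea : a = a' by apply: k_inj.
  case: (joinedP down_long ja') => [|[u [/down_long/andP[_ ul] El Eh]]].
    by rewrite -Ea (negbTE nab).
  have range_a : k a <= k a <= k b' by rewrite leqnn (ltnW (ltn_trans kab kbb')).
  rewrite -Ea in Qa'b El; have [_ _ _ /(_ b Qa'b kab)] := range_ab a aT range_a.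
  case=> [Eb|[_ Eb]]; first by move: ul; rewrite El Eh Eb ltnn.
  by move: kbb'; rewrite Eb ltnn.
- by have := cyclic_range_isolated range_ab bT range_b wi; rewrite bw.
Qed.

Lemma S_S_abuts a b : a \notin T -> b \notin T -> k a < k b -> adj a b -> abuts a b.
Proof.
move=> aT bT kab ab; have [_ ya _] := S_coords aT; have [_ _ zb] := S_coords bT.
rewrite /abuts ya zb; have [_ _ [->|[b' jab' ->]]] := zhi_S aT.
  have -> : level (k a) + n.+1 <= level (k b); last by rewrite !orbT.
  by have := level_gap kab; rewrite addnS; apply: ltnW.
have [lt|le] := ltnP (k b) (k b'); last by rewrite (leq_level le) !orbT.
by have := S_S_crossing aT bT kab lt jab'; rewrite ab => ->; rewrite orbT.
Qed.

(** The third coordinate separates unless [a] stretches up to [b] or beyond. Beyond [b],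
    [S_S_crossing] applies; exactly at [b], an up-end closes the cycle, so [b] is not stretched in
    the second coordinate. *)
Lemma S_S_sep a b : a \notin T -> b \notin T -> k a < k b -> ~~ adj a b -> left_of a b.
Proof.
move=> aT bT kab ab; have [_ ya _] := S_coords aT; have [_ _ zb] := S_coords bT.
rewrite /left_of ya zb; have [_ _ [->|[b' jab' ->]]] := zhi_S aT.
  have -> : level (k a) + n.+1 < level (k b); last by rewrite !orbT.
  by have := level_gap kab; rewrite addnS.
have [lt|gt|E] := ltngtP (k b) (k b').
- by have := S_S_crossing aT bT kab lt jab'; rewrite (negbTE ab) => ->; rewrite orbT.
- by rewrite ltn_level gt !orbT.
have [_ bT' _ _] := and4P jab'; have Eb : b = b' by apply: k_inj.
case: (joinedP up_long jab') => [|[u [uu El Eh]]]; first by rewrite -Eb (negbTE ab).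
have [ul notlow] := andP uu.
rewrite (ylo_long ul bT) ?ltn_level ?kab ?orbT //; last by left;
  rewrite /down_end ul (negbTE notlow).
by rewrite El Eh -Eb leqnn ltnW.
Qed.

Lemma coordinates_correct u v : u != v ->
  if adj u v then [&& meet u v, meet v u & abuts u v || abuts v u]
  else left_of u v || left_of v u.
Proof.
have S_S a b : a \notin T -> b \notin T -> k a < k b ->
    if adj a b then [&& meet a b, meet b a & abuts a b || abuts b a]
    else left_of a b || left_of b a.
  move=> aT bT kab; case: ifPn => ab; last by rewrite S_S_sep.
  by have [-> ->] := S_S_meet aT bT kab ab; rewrite S_S_abuts.
have T_T a b : nonisolated a -> nonisolated b -> pos a < pos b ->
    if adj a b then [&& meet a b, meet b a & abuts a b || abuts b a]
    else left_of a b || left_of b a.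
  move=> aT bT pab; have := T_T_sep aT bT pab; case: ifP => ab ->; last by [].
  by rewrite !T_T_meet // adjC.
have S_T s t : s \notin T -> t \in T ->
    if adj s t then [&& meet s t, meet t s & abuts s t || abuts t s]
    else left_of s t || left_of t s.
  move=> sT tT; have [ti|ti] := boolP (t \in isolated).
    case: ifPn => st; last by rewrite orbC isolated_S_nonadj.
    by have [-> -> ->] := isolated_S_adj ti sT st; rewrite orbT.
  have tt : nonisolated t by rewrite /nonisolated tT.
  rewrite adjC; case: ifPn => st; last exact: S_T_sep.
  by have [-> ->] := S_T_meet sT tt st; rewrite S_T_abuts.
have flip a b : (if adj b a then [&& meet b a, meet a b & abuts b a || abuts a b]
    else left_of b a || left_of a b) =
    (if adj a b then [&& meet a b, meet b a & abuts a b || abuts b a]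
    else left_of a b || left_of b a).
  by rewrite [adj b a]adjC [left_of b a || _]orbC [abuts b a || _]orbC andbCA.
move=> uv; have [uT|uT] := boolP (u \in T); have [vT|vT] := boolP (v \in T).
- have [ui|ui] := boolP (u \in isolated); first by rewrite isolated_adjT // isolated_T.
  have [vi|vi] := boolP (v \in isolated).
    by rewrite adjC isolated_adjT // orbC isolated_T // eq_sym.
  have ut : nonisolated u by rewrite /nonisolated uT.
  have vt : nonisolated v by rewrite /nonisolated vT.
  have [lt|lt|E] := ltngtP (pos u) (pos v); [exact: T_T|by rewrite -flip; apply: T_T|].
  by move: uv; rewrite (pos_inj uT vT E) eqxx.
- by rewrite -flip; apply: S_T.
- exact: S_T.
- have [lt|lt|E] := ltngtP (k u) (k v); [exact: S_S|by rewrite -flip; apply: S_S|].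
  by move: uv; rewrite (k_inj uT vT E) eqxx.
Qed.
End Coordinates.
End Levels.
End Placement.

(** * From coordinates to boxes in real space *)

Lemma box_coordinates (V : finType) (adj : rel V) : symmetric adj -> irreflexive adj ->
  (forall v, #|[set w | adj v w]| <= 3) ->
  exists lo hi : 'I_3 -> V -> nat,
  [/\ forall i v, lo i v <= hi i v,
      forall u v, u != v -> adj u v -> forall i, lo i u <= hi i v,
      forall u v, u != v -> ~~ adj u v -> exists i, hi i u < lo i v \/ hi i v < lo i u
    & forall u v, u != v -> adj u v -> exists i, hi i u <= lo i v \/ hi i v <= lo i u].
Proof.
move=> adjC adjI deg3; have [T Topt] := optimal_exists adjC adjI deg3.
have [k klay] : exists k, layout (quotient_edge adj T) (good_cut adj) (~: T) k.
  apply: layout_exists; [exact: quotient_edgeC|exact: quotient_edgeI| |exact: good_cut_exists].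
  by move=> s; rewrite inE; apply: quotient_nbrs.
have [pos play] : exists pos, layout adj (good_start adj T k) T pos.
  apply: layout_exists => //; first exact: T_nbrs_le2.
  by move=> c _ _ c2 _; apply: good_start_exists.
pose lo (i : 'I_3) v :=
  nth 0 [:: xlo adj T pos v; ylo adj T k v; zlo adj T k v] i.
pose hi (i : 'I_3) v :=
  nth 0 [:: xhi adj T pos v; yhi adj T k v; zhi adj T k v] i.
have correct := coordinates_correct adjC adjI deg3 Topt klay play.
have meetP u v : meet adj T k pos u v -> forall i, lo i u <= hi i v.
  by case/and3P => mx my mz [[|[|[|]]]].
have abutsP u v : abuts adj T k pos u v -> exists i, hi i u <= lo i v.
  by case/or3P; [exists (@Ordinal 3 0 isT)|exists (@Ordinal 3 1 isT)|exists (@Ordinal 3 2 isT)].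
have left_ofP u v : left_of adj T k pos u v -> exists i, hi i u < lo i v.
  by case/or3P; [exists (@Ordinal 3 0 isT)|exists (@Ordinal 3 1 isT)|exists (@Ordinal 3 2 isT)].
exists lo, hi; split.
- by move=> i v; apply: meetP; apply: lo_le_hi.
- by move=> u v /correct + uv; rewrite uv => /and3P[/meetP].
- move=> u v /correct + /negbTE uv; rewrite uv.
  by case/orP => /left_ofP[i h]; exists i; [left|right].
- move=> u v /correct + uv; rewrite uv => /and3P[_ _].
  by case/orP => /abutsP[i h]; exists i; [left|right].
Qed.

From mathcomp Require Import all_order all_algebra.
From mathcomp Require Import all_classical all_reals all_analysis.

Import Order.TTheory GRing.Theory Num.Theory.
Import numFieldNormedType.Exports.

Local Open Scope classical_set_scope.
Local Open Scope ring_scope.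

Lemma interior_box (R : realType) (a b x : 'rV[R]_3) (i : 'I_3) :
  interior (box a b) x -> a 0 i < x 0 i < b 0 i.
Proof.
move=> /nbhs_ballP[e /= e0 sub].
(* The point [x] moved by [d] along axis [i]; moves by [e / 2] both ways stay in the ball. *)
pose y (d : R) : 'rV[R]_3 := \row_j (x 0 j + d *+ (j == i)).
have y_box d : `|d| < e -> box a b (y d).
  move=> de; apply: sub; split=> // i0 j;
    rewrite (ord1 i0) /y mxE /ball /= opprD addrA subrr add0r normrN.
  by case: (j == i); rewrite ?mulr1n ?mulr0n // normr0.
have e2 : 0 < e / 2 by rewrite divr_gt0.
have e2e : e / 2 < e by rewrite ltr_pdivrMr // ltr_pMr // ltr1n.
have := y_box (e / 2); rewrite gtr0_norm // => /(_ e2e i).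
have := y_box (- (e / 2)); rewrite normrN gtr0_norm // => /(_ e2e i).
rewrite /y !mxE eqxx !mulr1n => /andP[la _] /andP[_ lb].
by rewrite (le_lt_trans la) ?(lt_le_trans _ lb) // ?ltrDl ?ltrBlDr ?ltrDl.
Qed.

Theorem theorem1 (R : realType) (V : finType) (adj : rel V)
    (adj_simple : simple_graph adj)
    (deg_le3 : forall v : V, (degree adj v <= 3)%N) :
  exists B : V -> set 'rV[R]_3,
    [/\ forall v : V, is_box (B v),
        forall u v : V, u <> v -> (B u `&` B v !=set0 <-> adj u v)
      & forall u v : V, u <> v ->
          B u `&` B v `&` interior (B u) = set0 /\
          B u `&` B v `&` interior (B v) = set0].
Proof.
have [adjC adjI] := adj_simple.
have [|lo [hi [lohi meet sep abut]]] := box_coordinates adjC adjI.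
  by move=> v; rewrite cardsE; apply: deg_le3.
pose L v : 'rV[R]_3 := \row_i (lo i v)%:R.
pose H v : 'rV[R]_3 := \row_i (hi i v)%:R.
have boxE v (x : 'rV[R]_3) i : box (L v) (H v) x -> (lo i v)%:R <= x 0 i <= (hi i v)%:R.
  by move=> /(_ i); rewrite !mxE.
have adj_of u v x : u <> v -> box (L u) (H u) x -> box (L v) (H v) x -> adj u v.
  move=> /eqP uv xu xv; apply: contraT => /(sep u v uv)[i h]; exfalso.
  have /andP[u1 u2] := boxE u x i xu; have /andP[v1 v2] := boxE v x i xv.
  have := le_trans v1 u2; have := le_trans u1 v2; rewrite !ler_nat => h1 h2.
  by case: h; rewrite ltnNge ?h1 ?h2.
have inter u v x : u <> v -> box (L u) (H u) x -> box (L v) (H v) x ->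
    interior (box (L u) (H u)) x -> False.
  move=> uv xu xv xint; have uv' := adj_of u v x uv xu xv; move/eqP: uv => uv.
  have [i h] := abut u v uv uv'.
  have /andP[v1 v2] := boxE v x i xv; have /andP[] := interior_box i xint; rewrite !mxE => l1 l2.
  case: h => h.
    by have := le_lt_trans v1 l2; rewrite ltr_nat ltnNge h.
  by have := lt_le_trans l1 v2; rewrite ltr_nat ltnNge h.
exists (fun v => box (L v) (H v)); split.
- by move=> v; exists (L v), (H v); split=> // i; rewrite !mxE ler_nat.
- move=> u v uv; split=> [[x [xu xv]]|adj_uv]; first exact: adj_of xu xv.
  (* The coordinatewise maximum of the lower corners lies in both boxes. *)
  have /eqP uv' := uv; exists (\row_i (maxn (lo i u) (lo i v))%:R).
  have vu' : v != u by rewrite eq_sym.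
  by split=> i; rewrite !mxE !ler_nat ?leq_maxl ?leq_maxr geq_max lohi meet // adjC.
- move=> u v uv; split; rewrite -subset0 => x [[xu xv] xint].
    exact: inter uv xu xv xint.
  by apply: inter xv xu xint => E; apply: uv.
Qed.
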